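(* Let $M$ be an almost Hermitian manifold of real dimension $2m$ with almost complex structure $J$ and Hermitian metric $g$, let $\sigma\in C^\infty(M)$ be real-valued, and $g'=e^{2\sigma}g$. Let $\rho$ be a dominant integral weight of $U(m)$, and let $D_{\pm i}$, $D'_{\pm i}$ $(1\le i\le m)$ be the Kählerian gradients on $\mathbf{S}_\rho$ (with respect to $(g,J)$) and on $\mathbf{S}'_\rho$ (with respect to $(g',J)$), and $\psi_\rho,\psi_{\rho\pm\mu_i}$ the bundle isomorphisms induced by the conformal change, as in the context. (1) Suppose $M$ is a Hermitian manifold (that is, $J$ is integrable), and $D_{\pm i}$, $D'_{\pm i}$ are defined with the Hermitian connections of $g$ and $g'$ respectively. Then $$D'_{\pm i}=e^{(\pm\pi_\rho(c_1)-1)\sigma}\,\psi_{\rho\pm\mu_i}\circ D_{\pm i}\circ\big(e^{\pm\pi_\rho(c_1)\sigma}\psi_\rho\big)^{-1},$$ where $\pi_\rho(c_1)=\sum_{i=1}^m\rho^i$ is the value of the Casimir element $c_1=\sum_k e_{kk}$ on $V_\rho$. (2) Let $M$ be almost Hermitian, and let $D_{\pm i}$, $D'_{\pm i}$ be defined with the $\mathfrak{u}(m)$-components of the Levi-Civita connections of $g$ and $g'$ respectively. Then $$D'_{\pm i}=e^{(-w_{\pm i}-1)\sigma}\,\psi_{\rho\pm\mu_i}\circ D_{\pm i}\circ\big(e^{-w_{\pm i}\sigma}\psi_\rho\big)^{-1},$$ where $w_{+i}=-\rho^i+i-1$ and $w_{-i}=\rho^i+m-i$.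
   Context: Representations. Irreducible unitary representations $(\pi_\rho,V_\rho)$ of $U(m)$ are labelled by highest weights $\rho=(\rho^1,\dots,\rho^m)\in\mathbb{Z}^m$, $\rho^1\ge\cdots\ge\rho^m$ (''dominant integral''), where weights are the simultaneous eigenvalues of the diagonal matrix units $e_{11},\dots,e_{mm}$. Let $\mu_i$ be the $i$-th standard basis vector of $\mathbb{Z}^m$. One has multiplicity-free orthogonal decompositions $V_\rho\otimes\mathbb{C}^m=\bigoplus_iV_{\rho+\mu_i}$ and $V_\rho\otimes\overline{\mathbb{C}^m}=\bigoplus_iV_{\rho-\mu_i}$, with $V_{\rho\pm\mu_i}:=\{0\}$ when $\rho\pm\mu_i$ is not dominant integral; $\Pi_{\pm i}$ denotes the orthogonal projection onto $V_{\rho\pm\mu_i}$. Kählerian gradients. $(M,g,J)$ is almost Hermitian: $g$ is a Riemannian metric with $g(JX,JY)=g(X,Y)$, extended complex bilinearly. $\mathbf{U}(M)$ is the principal $U(m)$-bundle of unitary frames $(\epsilon_1,\dots,\epsilon_m)$ of $T^{1,0}(M)$, with Hermitian metric $g(\cdot,\bar\cdot)$. Put $\mathbf{S}_\rho:=\mathbf{U}(M)\times_{\pi_\rho}V_\rho$ (zero bundle if $\rho$ is not dominant integral). A connection on $\mathbf{U}(M)$ (a linear connection preserving $g$ and $J$) induces $\nabla=\nabla^{1,0}+\nabla^{0,1}$ on $\mathbf{S}_\rho$. Using $g$ to identify $\Lambda^{0,1}(M)\simeq T^{1,0}(M)$, $\Lambda^{1,0}(M)\simeq T^{0,1}(M)$,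 one has $\nabla^{0,1}\phi=\sum_k\nabla_{\bar\epsilon_k}\phi\otimes\epsilon_k$ and $\nabla^{1,0}\phi=\sum_k\nabla_{\epsilon_k}\phi\otimes\bar\epsilon_k$. The Kählerian gradients are $D_{+i}:=\Pi_{+i}\circ\nabla^{0,1}:\Gamma(\mathbf{S}_\rho)\to\Gamma(\mathbf{S}_{\rho+\mu_i})$ and $D_{-i}:=\Pi_{-i}\circ\nabla^{1,0}:\Gamma(\mathbf{S}_\rho)\to\Gamma(\mathbf{S}_{\rho-\mu_i})$, with $\Pi_{\pm i}$ applied fibrewise. Connections. The Hermitian connection ($J$ integrable) is the unique connection with $\nabla g=0$, $\nabla J=0$ and vanishing $(1,1)$-part of the torsion (the Chern connection). The $\mathfrak{u}(m)$-component of the Levi-Civita connection $\nabla^g$ is $\nabla^u_VW=\tfrac12\big(\nabla^g_VW-J(\nabla^g_V(JW))\big)$. Conformal change. For $g'=e^{2\sigma}g$, let $\mathbf{U}'(M)$, $\mathbf{S}'_\rho$ be the bundles built from $(g',J)$. The map $p=(\epsilon_1,\dots,\epsilon_m)\mapsto p'=e^{-\sigma}(\epsilon_1,\dots,\epsilon_m)$ is a principal bundle isomorphism $\mathbf{U}(M)\to\mathbf{U}'(M)$, and $\psi_\rho:\mathbf{S}_\rho\to\mathbf{S}'_\rho$, $[p,\phi]\mapsto[p',\phi]$. *)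

(* Defs.v *)
From HB Require Import structures.
From mathcomp Require Import all_boot all_order all_algebra.
From mathcomp Require Import all_classical all_reals.
From mathcomp Require Import topology normedtype sequences derive exp.
From mathcomp Require Import complex.

Set Implicit Arguments.
Unset Strict Implicit.
Unset Printing Implicit Defensive.
Import Order.TTheory GRing.Theory Num.Theory.
Import numFieldNormedType.Exports.

Local Open Scope classical_set_scope.
Local Open Scope ring_scope.
Local Open Scope complex_scope.
Local Open Scope sesquilinear_scope.

(* Conventions: matrices act on tangent vectors (row vectors) from the right; *)
(* matrices act on representation spaces (columns) from the left.             *)

Section ComplexMatrices.
Variables (R : realType) (p q : nat).
Implicit Types (A : 'M[R[i]]_(p, q)).

Definition reM A : 'M[R]_(p, q) := map_mx (@complex.Re R) A.
Definition imM A : 'M[R]_(p, q) := map_mx (@complex.Im R) A.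
Definition cplxM (A B : 'M[R]_(p, q)) : 'M[R[i]]_(p, q) :=
  \matrix_(a, b) (A a b +i* B a b).
Definition conjM A : 'M[R[i]]_(p, q) := map_mx Num.conj A.
Definition adjM A : 'M[R[i]]_(q, p) := A ^t*.
Definition hdot A B : R[i] := \tr (A *m adjM B).

End ComplexMatrices.

Section CurveDerivative.
Variables (R : realType) (p q : nat).

Definition curve_deriv0 (c : R -> 'M[R[i]]_(p, q)) (A : 'M[R[i]]_(p, q)) :=
  forall a b,
    is_derive (0 : R) (1 : R) (fun t => complex.Re (c t a b)) (complex.Re (A a b)) /\
    is_derive (0 : R) (1 : R) (fun t => complex.Im (c t a b)) (complex.Im (A a b)).

End CurveDerivative.

(* A unitary representation of U(m) on C^N (only the values of [rep_fun] on   *)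
(* unitary matrices matter), with the complex-linear extension to             *)
(* gl(m, C) = u(m) (x) C of its differential at 1; [rep_diffP] determines     *)
(* [rep_diff] uniquely, and holds for the differential of every continuous    *)
(* finite-dimensional representation.                                         *)
Record unitary_rep (R : realType) (m N : nat) := UnitaryRep {
  rep_fun :> 'M[R[i]]_m -> 'M[R[i]]_N ;
  rep_diff : {linear 'M[R[i]]_m -> 'M[R[i]]_N} ;
  rep_unitary : forall a, a \is unitarymx -> rep_fun a \is unitarymx ;
  rep_mul : forall a b, a \is unitarymx -> b \is unitarymx ->
    rep_fun (a *m b) = rep_fun a *m rep_fun b ;
  rep_diffP : forall (c : R -> 'M[R[i]]_m) (A : 'M[R[i]]_m),
    (forall t, c t \is unitarymx) -> c 0 = 1%:M -> curve_deriv0 c A ->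
    curve_deriv0 (rep_fun \o c) (rep_diff A) }.

Section Weights.
Variable m : nat.

Definition weight := 'I_m -> int.

Definition dominant (la : weight) : bool :=
  [forall k : 'I_m, forall l : 'I_m, (k <= l)%N ==> (la l <= la k)].

Definition mu (k : 'I_m) : weight := fun j => (j == k)%:Z.

End Weights.

Section SubRepresentations.
Variables (R : realType) (m : nat) (V : vectType R[i]).
(* A group action of U(m) on V and the associated action of gl(m, C). *)
Variables (act dact : 'M[R[i]]_m -> V -> V).

Definition invariant (W : {vspace V}) :=
  forall a v, a \is unitarymx -> v \in W -> act a v \in W.

Definition irreducible (W : {vspace V}) :=
  [/\ W != 0%VS, invariant W &
      forall U : {vspace V}, (U <= W)%VS -> invariant U -> U = 0%VS \/ U = W].

Definition weight_vector (la : weight m) (v : V) :=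
  v != 0 /\ forall k : 'I_m, dact (delta_mx k k) v = (la k)%:~R *: v.

Definition highest_weight_vector (la : weight m) (v : V) :=
  weight_vector la v /\
  forall k l : 'I_m, (k < l)%N -> dact (delta_mx k l) v = 0.

Definition irreducible_hw (la : weight m) (W : {vspace V}) :=
  irreducible W /\ exists2 v, v \in W & highest_weight_vector la v.

End SubRepresentations.

Section Kahlerian_representations.
Variables (R : realType) (m N : nat) (pi : unitary_rep R m N).

Definition ract (a : 'M[R[i]]_m) (v : 'cV[R[i]]_N) := pi a *m v.
Definition rdact (A : 'M[R[i]]_m) (v : 'cV[R[i]]_N) := rep_diff pi A *m v.

Definition irrep_of_hw (la : weight m) :=
  irreducible_hw ract rdact la fullv.

Definition casimir1 : 'M[R[i]]_N := rep_diff pi (\sum_k delta_mx k k).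

(* V (x) C^m and V (x) conj(C^m) are both modelled by N x m matrices, v (x) w *)
(* being v *m w^T.  On conj(C^m) the group acts by the conjugate matrix, so   *)
(* that A in gl(m, C) acts by - A^T.                                          *)
Definition tens (a : 'M[R[i]]_m) (X : 'M[R[i]]_(N, m)) := pi a *m X *m a^T.
Definition dtens (A : 'M[R[i]]_m) (X : 'M[R[i]]_(N, m)) :=
  rep_diff pi A *m X + X *m A^T.
Definition ctens (a : 'M[R[i]]_m) (X : 'M[R[i]]_(N, m)) := pi a *m X *m adjM a.
Definition dctens (A : 'M[R[i]]_m) (X : 'M[R[i]]_(N, m)) :=
  rep_diff pi A *m X - X *m A.

(* The summand V_la of V (x) C^m or V (x) conj(C^m), zero when la is not      *)
(* dominant integral, with the orthogonal projection onto it.                 *)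
Record summand (act dact : 'M[R[i]]_m -> 'M[R[i]]_(N, m) -> 'M[R[i]]_(N, m))
    (la : weight m) := Summand {
  sumd_space : {vspace 'M[R[i]]_(N, m)} ;
  sumd_proj : 'M[R[i]]_(N, m) -> 'M[R[i]]_(N, m) ;
  sumd_spaceP : if dominant la then irreducible_hw act dact la sumd_space
                else sumd_space = 0%VS ;
  sumd_projP : forall X, sumd_proj X \in sumd_space /\
    forall Y, Y \in sumd_space -> hdot (X - sumd_proj X) Y = 0 }.

Definition summand_plus (rho : weight m) (k : 'I_m) :=
  summand tens dtens (fun j => rho j + mu k j).
Definition summand_minus (rho : weight m) (k : 'I_m) :=
  summand ctens dctens (fun j => rho j - mu k j).

End Kahlerian_representations.

Section SmoothFunctions.
Variables (R : realType) (n : nat).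

Fixpoint times_differentiable (k : nat) (E : set 'rV[R]_n) (f : 'rV[R]_n -> R)
    : Prop :=
  if k is j.+1 then
    (forall u, E u -> differentiable f u) /\
    forall v, times_differentiable j E ('D_v f)
  else True.

Definition smooth_on (E : set 'rV[R]_n) (f : 'rV[R]_n -> R) :=
  forall k, times_differentiable k E f.

End SmoothFunctions.

(* The smooth structure is given by an atlas indexed by the points of M, the  *)
(* chart [chart x] being defined on a neighbourhood [cdom x] of x.            *)
Record manifold (R : realType) (n : nat) := Manifold {
  points :> topologicalType ;
  cdom : points -> set points ;
  chart : points -> points -> 'rV[R]_n ;
  chartV : points -> 'rV[R]_n -> points ;
  points_hausdorff : hausdorff_space points ;
  points_second_countable : @second_countable points ;
  cdom_open : forall x, open (cdom x) ;
  cdom_center : forall x, cdom x x ;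
  chart_image_open : forall x, open (chart x @` cdom x) ;
  chartK : forall x y, cdom x y -> chartV x (chart x y) = y ;
  chart_continuous : forall x y, cdom x y -> {for y, continuous (chart x)} ;
  chartV_continuous : forall x u, (chart x @` cdom x) u ->
    {for u, continuous (chartV x)} ;
  chart_transition : forall x y j,
    smooth_on (chart x @` (cdom x `&` cdom y))
              (fun u => chart y (chartV x u) 0 j) }.

(* T_x M is R^n by means of the chart [chart x]. *)
Section Calculus.
Variables (R : realType) (n : nat) (M : manifold R n).
Implicit Types (x : M) (U : set M) (X Y Z : M -> 'rV[R]_n).

Definition msmooth U (f : M -> R) :=
  forall x, smooth_on (chart x @` (U `&` cdom x)) (f \o chartV x).

Definition der x (v : 'rV[R]_n) (f : M -> R) : R :=
  'D_v (f \o chartV x) (chart x x).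

Definition vf_smooth U X :=
  forall V (f : M -> R), open V -> V `<=` U -> msmooth V f ->
  msmooth V (fun y => der y (X y) f).

Definition bracket X Y x : 'rV[R]_n :=
  \row_j (der x (X x) (fun y => der y (Y y) (fun z => chart x z 0 j))
        - der x (Y x) (fun y => der y (X y) (fun z => chart x z 0 j))).

Definition cmsmooth U p q (F : M -> 'M[R[i]]_(p, q)) :=
  forall a b, msmooth U (fun y => complex.Re (F y a b)) /\
              msmooth U (fun y => complex.Im (F y a b)).

Definition cvf_smooth U (Z : M -> 'rV[R[i]]_n) :=
  vf_smooth U (fun y => reM (Z y)) /\ vf_smooth U (fun y => imM (Z y)).

(* derivative of a complex matrix-valued function along w in T_x M (x) C *)
Definition cder p q x (w : 'rV[R[i]]_n) (F : M -> 'M[R[i]]_(p, q))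
    : 'M[R[i]]_(p, q) :=
  \matrix_(a, b)
    let f := fun y => complex.Re (F y a b) in
    let h := fun y => complex.Im (F y a b) in
    (der x (reM w) f - der x (imM w) h) +i* (der x (reM w) h + der x (imM w) f).

(* [nab x v Y] is the covariant derivative of the local field Y along v in    *)
(* T_x M; its value is meaningful when Y is smooth near x.                    *)
Definition covariant := M -> 'rV[R]_n -> (M -> 'rV[R]_n) -> 'rV[R]_n.
Implicit Types nab : covariant.

Definition is_connection nab :=
  forall U, open U ->
  [/\ forall x (a : R) u v Y, U x -> vf_smooth U Y ->
        nab x (a *: u + v) Y = a *: nab x u Y + nab x v Y,
      forall x v Y Z, U x -> vf_smooth U Y -> vf_smooth U Z ->
        nab x v (fun y => Y y + Z y) = nab x v Y + nab x v Z,
      forall x v (f : M -> R) Y, U x -> msmooth U f -> vf_smooth U Y ->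
        nab x v (fun y => f y *: Y y) = der x v f *: Y x + f x *: nab x v Y &
      forall X Y, vf_smooth U X -> vf_smooth U Y ->
        vf_smooth U (fun y => nab y (X y) Y)].

Definition torsion nab X Y x := nab x (X x) Y - nab x (Y x) X - bracket X Y x.

Definition nabC nab x (w : 'rV[R[i]]_n) (Z : M -> 'rV[R[i]]_n) : 'rV[R[i]]_n :=
  let Zr := fun y => reM (Z y) in let Zi := fun y => imM (Z y) in
  cplxM (nab x (reM w) Zr - nab x (imM w) Zi)
        (nab x (reM w) Zi + nab x (imM w) Zr).

Definition torsionC nab (Z W : M -> 'rV[R[i]]_n) x : 'rV[R[i]]_n :=
  let Zr := fun y => reM (Z y) in let Zi := fun y => imM (Z y) in
  let Wr := fun y => reM (W y) in let Wi := fun y => imM (W y) in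
  cplxM (torsion nab Zr Wr x - torsion nab Zi Wi x)
        (torsion nab Zr Wi x + torsion nab Zi Wr x).

End Calculus.

Section AlmostHermitian.
Variables (R : realType) (m : nat) (M : manifold R m.*2).
Notation T := 'rV[R]_m.*2.
Notation TC := 'rV[R[i]]_m.*2.
Implicit Types (J g : M -> 'M[R]_m.*2) (nab : covariant M).
Implicit Types (x : M) (U : set M) (X Y : M -> T).

Definition gdot g x (u v : T) : R := (u *m g x *m v^T) 0 0.
Definition Jfield J X : M -> T := fun y => X y *m J y.

Definition is_metric g :=
  [/\ forall x u v, gdot g x u v = gdot g x v u,
      forall x u, u != 0 -> 0 < gdot g x u u &
      forall U X Y, open U -> vf_smooth U X -> vf_smooth U Y ->
        msmooth U (fun y => gdot g y (X y) (Y y))].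

Definition is_almost_complex J :=
  (forall x, J x *m J x = - 1%:M) /\
  (forall U X, open U -> vf_smooth U X -> vf_smooth U (Jfield J X)).

Definition is_almost_hermitian J g :=
  [/\ is_almost_complex J, is_metric g &
      forall x u v, gdot g x (u *m J x) (v *m J x) = gdot g x u v].

(* vanishing of the Nijenhuis tensor *)
Definition integrable J :=
  forall U X Y x, open U -> U x -> vf_smooth U X -> vf_smooth U Y ->
  bracket (Jfield J X) (Jfield J Y) x - bracket (Jfield J X) Y x *m J x
    - bracket X (Jfield J Y) x *m J x - bracket X Y x = 0.

Definition parallel_metric g nab :=
  forall U X Y x v, open U -> U x -> vf_smooth U X -> vf_smooth U Y ->
  der x v (fun y => gdot g y (X y) (Y y))
    = gdot g x (nab x v X) (Y x) + gdot g x (X x) (nab x v Y).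

Definition parallel_complex J nab :=
  forall U X x v, open U -> U x -> vf_smooth U X ->
  nab x v (Jfield J X) = nab x v X *m J x.

Definition levi_civita g nab :=
  [/\ is_connection nab, parallel_metric g nab &
      forall U X Y x, open U -> U x -> vf_smooth U X -> vf_smooth U Y ->
        torsion nab X Y x = 0].

Definition u_component J nab : covariant M := fun x v Y =>
  2^-1 *: (nab x v Y - nab x v (Jfield J Y) *m J x).

Definition type10 J x (w : TC) :=
  w *m map_mx (real_complex R) (J x) = (0 +i* 1) *: w.

Definition hermitian_connection J g nab :=
  [/\ is_connection nab, parallel_metric g nab, parallel_complex J nab &
      forall U (Z W : M -> TC) x, open U -> U x ->
        cvf_smooth U Z -> cvf_smooth U W ->
        (forall y, U y -> type10 J y (Z y)) ->
        (forall y, U y -> type10 J y (W y)) ->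
        torsionC nab Z (fun y => conjM (W y)) x = 0].

Definition gdotC g x (u w : TC) : R[i] :=
  (u *m map_mx (real_complex R) (g x) *m w^T) 0 0.

(* The rows of p : 'M_(m, 2m) are the vectors e_1, ..., e_m of the frame. *)
Definition unitary_frame J g x (p : 'M[R[i]]_(m, m.*2)) :=
  (forall k, type10 J x (row k p)) /\
  (forall k l, gdotC g x (row k p) (conjM (row l p)) = (k == l)%:R).

Definition frame_field J g U (eps : M -> 'M[R[i]]_(m, m.*2)) :=
  (forall y, U y -> unitary_frame J g y (eps y)) /\
  (forall k, cvf_smooth U (fun y => row k (eps y))).

End AlmostHermitian.

Section AssociatedBundles.
Variables (R : realType) (m : nat) (M : manifold R m.*2).
Notation frame := 'M[R[i]]_(m, m.*2).

(* The class [p, v] = { (p a, a^-1 v) | a in U(m) }, where p a is the frame   *)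
(* (sum_j a_jk e_j)_k. *)
Definition bclass (E : Type) (act : 'M[R[i]]_m -> E -> E) (p : frame) (v : E)
    : set (frame * E) :=
  [set z | exists2 a : 'M[R[i]]_m, a \is unitarymx &
                   z = (a^T *m p, act (adjM a) v)].

(* A section assigns to each x the class [p, v] (as a set of pairs).          *)
Definition bsection (E : Type) := M -> set (frame * E).

Section Gradients.
Variables (N : nat) (J g : M -> 'M[R]_m.*2) (pi : unitary_rep R m N).
Implicit Types (U : set M) (eps : M -> frame) (f : M -> 'cV[R[i]]_N).
Implicit Types (s : bsection 'cV[R[i]]_N).

(* s = [eps, f] over U *)
Definition local_expr U eps f s :=
  [/\ frame_field J g U eps, cmsmooth U f &
      forall y, U y -> s y = bclass (ract pi) (eps y) (f y)].

Definition smooth_section s :=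
  forall x, exists U eps f, [/\ open U, U x & local_expr U eps f s].

Variable nab : covariant M.

(* connection matrix: nab_w eps_l = sum_k omega_kl eps_k *)
Definition omega eps x (w : 'rV[R[i]]_m.*2) : 'M[R[i]]_m :=
  \matrix_(k, l) gdotC g x (nabC nab x w (fun y => row l (eps y)))
                           (conjM (row k (eps x))).

(* nab_w [eps, f] = [eps, cov eps f x w] *)
Definition cov eps f x (w : 'rV[R[i]]_m.*2) : 'cV[R[i]]_N :=
  cder x w f + rep_diff pi (omega eps x w) *m f x.

(* nab^{0,1} = sum_k nab_{conj eps_k} (x) eps_k and                           *)
(* nab^{1,0} = sum_k nab_{eps_k} (x) conj eps_k in the frame eps.             *)
Definition nab01 eps f x : 'M[R[i]]_(N, m) :=
  \matrix_(a, k) cov eps f x (conjM (row k (eps x))) a 0.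
Definition nab10 eps f x : 'M[R[i]]_(N, m) :=
  \matrix_(a, k) cov eps f x (row k (eps x)) a 0.

(* Union of the classes [eps x, Pi (nab s)] over the local expressions        *)
(* s = [eps, f] near x; all these classes coincide.                           *)
Definition kgrad_plus rho k (S : summand_plus pi rho k) s
    : bsection 'M[R[i]]_(N, m) := fun x =>
  [set z | exists U eps f, [/\ open U, U x, local_expr U eps f s &
     bclass (tens pi) (eps x) (sumd_proj S (nab01 eps f x)) z]].

Definition kgrad_minus rho k (S : summand_minus pi rho k) s
    : bsection 'M[R[i]]_(N, m) := fun x =>
  [set z | exists U eps f, [/\ open U, U x, local_expr U eps f s &
     bclass (ctens pi) (eps x) (sumd_proj S (nab10 eps f x)) z]].

End Gradients.

Section ConformalChange.
Variables (sigma : M -> R) (E : lmodType R[i]).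

Definition conformal (g : M -> 'M[R]_m.*2) : M -> 'M[R]_m.*2 :=
  fun x => expR (2 * sigma x) *: g x.

(* e^(w sigma) psi : [p, v] |-> [e^(- sigma) p, e^(w sigma) v] *)
Definition wpsi_at (w : R) (x : M) (z : frame * E) : frame * E :=
  ((expR (- sigma x))%:C *: z.1, (expR (w * sigma x))%:C *: z.2).

Definition wpsi (w : R) (s : bsection E) : bsection E :=
  fun x => wpsi_at w x @` s x.

(* the inverse of [wpsi w] *)
Definition wpsiV (w : R) (s : bsection E) : bsection E :=
  fun x => wpsi_at w x @^-1` s x.

End ConformalChange.

End AssociatedBundles.

Definition weight_sum (m : nat) (rho : weight m) : int := \sum_k rho k.
(* k : 'I_m is counted from 0, hence stands for the index k.+1. *)
Definition w_plus (m : nat) (rho : weight m) (k : 'I_m) : int :=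
  - rho k + k.+1%:Z - 1.
Definition w_minus (m : nat) (rho : weight m) (k : 'I_m) : int :=
  rho k + m%:Z - k.+1%:Z.

(* Main.v *)
Require Import Defs.
From HB Require Import structures.
From mathcomp Require Import all_boot all_order all_algebra.
From mathcomp Require Import all_classical all_reals.
From mathcomp Require Import topology normedtype sequences derive exp.
From mathcomp Require Import landau trigo.
From mathcomp Require Import complex.
From mathcomp Require Import ring zify.
Set Implicit Arguments.
Unset Strict Implicit.
Unset Printing Implicit Defensive.
Import Order.TTheory GRing.Theory Num.Theory.
Import numFieldNormedType.Exports.
Local Open Scope classical_set_scope.
Local Open Scope ring_scope.

(* The gradients are computed frame by frame. A local expression [eps, f] of  *)
(* a section for (g, J) becomes [e^(- sigma) eps, e^(c sigma) f] for (g', J), *)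
(* so one has to see that the projected covariant derivatives differ by the   *)
(* factor e^((c - 1) sigma). Apart from this factor they differ by the        *)
(* derivative of e^(c sigma) and by the action of D - d sigma, where D is the *)
(* difference of the two connections on (1,0)-vectors.                        *)
(*                                                                            *)
(* For the Hermitian connections, the vanishing (1,1)-torsion gives D_W Z = 0 *)
(* for W of type (0,1), hence by metricity D_W Z = 2 d sigma(W) Z for W of    *)
(* type (1,0). So D - d sigma is scalar and acts on V_rho through c_1; no     *)
(* projection is needed.                                                      *)
(*                                                                            *)
(* For the Levi-Civita connections, the Koszul argument gives D, and D - d    *)
(* sigma acts on V_rho (x) C^m (or its conjugate) by the split Casimir        *)
(* operator sum_pq E_pq (x) E_qp up to sign. It is half a difference of       *)
(* quadratic Casimir elements, hence a scalar on each irreducible summand,    *)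
(* the scalar being read off a highest weight vector; this is - w_(+i) or     *)
(* w_(-i).                                                                    *)

(** A section is a family of classes [frame, vector], and a gradient is the union of the classes
    computed from all local expressions. Both laws therefore reduce to one pointwise identity:
    [local_expr_conformal] and [local_expr_conformalV] match the local expressions for g and g', and
    [gradient_transport] passes from the identity to the sections. By [cov_matrix_conformal] the
    identity holds up to [grad_error], whose k-th column is c d sigma(w_k) f + dpi (D_(w_k) - d
    sigma(w_k)) f, where w_k is conj e_k or e_k. It remains to choose c so that the projection kills
    this term.

    Hermitian case: by [chern_diff] the vector D_(conj W) Z = D_Z (conj W) has both types, so it
    vanishes; [metric_diffC] then determines D in (1,0) directions. The error is a multiple of c +
    (b - 1) c_1 with b = 0 or 2, and [casimir1_scalar] evaluates c_1.

    Levi-Civita case: by [levi_civita_gdotC], D_Z W = d sigma(Z) W + d sigma(W) Z - g(Z, W) grad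
    sigma. Without its first term this has rank-one pieces in the frame, and [grad_error_lc01],
    [grad_error_lc10] recognize the error as c minus, or plus, a split Casimir operator applied to f
    (x) d sigma. The quadratic Casimir element acts on V_la by [casimir2_value]; comparing V_rho
    with V_(rho +- mu_k) gives the split operator on the summand, and its self-adjointness lets the
    projection pass through ([sumd_proj_split_plus], [sumd_proj_split_minus]).

    The Lie algebra facts about dpi come from differentiating identities of pi along explicit
    unitary curves, whose velocities span gl(m, C) ([skew_cubic_ext]). *)

Section LinearProp.
Variables (K : pzRingType) (U U' : lmodType K) (f : U -> U').
Hypothesis linf : linear f.

Lemma linear_prop0 : f 0 = 0.
Proof. by have := linf (-1) 0 0; rewrite !scaleN1r oppr0 addr0 addNr. Qed.

Lemma linear_propD x y : f (x + y) = f x + f y.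
Proof. by have := linf 1 x y; rewrite !scale1r. Qed.

Lemma linear_propZ z x : f (z *: x) = z *: f x.
Proof. by have := linf z x 0; rewrite linear_prop0 !addr0. Qed.

Lemma linear_propN x : f (- x) = - f x.
Proof. by rewrite -scaleN1r linear_propZ scaleN1r. Qed.

Lemma linear_prop_sum I (r : seq I) F :
  f (\sum_(i <- r) F i) = \sum_(i <- r) f (F i).
Proof.
elim: r => [|i r IH]; first by rewrite !big_nil linear_prop0.
by rewrite !big_cons linear_propD IH.
Qed.

End LinearProp.

(** * Complex-valued curves *)

Section ComplexParts.
Variable R : rcfType.
Implicit Types z w : R[i].

Lemma ReCD z w : complex.Re (z + w) = complex.Re z + complex.Re w.
Proof. by case: z; case: w. Qed.

Lemma ImCD z w : complex.Im (z + w) = complex.Im z + complex.Im w.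
Proof. by case: z; case: w. Qed.

Lemma ReCN z : complex.Re (- z) = - complex.Re z.
Proof. by case: z. Qed.

Lemma ImCN z : complex.Im (- z) = - complex.Im z.
Proof. by case: z. Qed.

Lemma ReCM z w :
  complex.Re (z * w) =
  complex.Re z * complex.Re w - complex.Im z * complex.Im w.
Proof. by case: z; case: w. Qed.

Lemma ImCM z w :
  complex.Im (z * w) =
  complex.Re z * complex.Im w + complex.Im z * complex.Re w.
Proof. by case: z => a b; case: w => c d /=. Qed.

Lemma ReCJ z : complex.Re (Num.conj z) = complex.Re z.
Proof. by case: z. Qed.

Lemma ImCJ z : complex.Im (Num.conj z) = - complex.Im z.
Proof. by case: z. Qed.

Definition ReImE := (ReCD, ImCD, ReCN, ImCN, ReCM, ImCM, ReCJ, ImCJ).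

Lemma complexP z w :
  complex.Re z = complex.Re w -> complex.Im z = complex.Im w -> z = w.
Proof. by case: z; case: w => a b c d /= -> ->. Qed.

Lemma conj_real (a : R) : Num.conj (a%:C)%C = (a%:C)%C :> R[i].
Proof. by apply: complexP; rewrite !ReImE /= ?oppr0. Qed.

End ComplexParts.

Section Adjoint.
Variable R : realType.

Lemma adjME p q (A : 'M[R[i]]_(p, q)) a b : adjM A a b = Num.conj (A b a).
Proof. by rewrite /adjM !mxE. Qed.

Lemma adjM_is_semilinear p q (c : R[i]) (A B : 'M[R[i]]_(p, q)) :
  adjM (c *: A + B) = Num.conj c *: adjM A + adjM B.
Proof. by apply/matrixP => a b; rewrite !(adjME, mxE) rmorphD rmorphM. Qed.

Lemma adjMD p q (A B : 'M[R[i]]_(p, q)) : adjM (A + B) = adjM A + adjM B.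
Proof. by rewrite -[A]scale1r adjM_is_semilinear rmorph1 !scale1r. Qed.

Lemma adjMZ p q c (A : 'M[R[i]]_(p, q)) : adjM (c *: A) = Num.conj c *: adjM A.
Proof. by apply/matrixP => a b; rewrite !(adjME, mxE) rmorphM. Qed.

Lemma adjMN p q (A : 'M[R[i]]_(p, q)) : adjM (- A) = - adjM A.
Proof. by apply/matrixP => a b; rewrite !(adjME, mxE) rmorphN. Qed.

Lemma adjM_mul p q r (A : 'M[R[i]]_(p, q)) (B : 'M[R[i]]_(q, r)) :
  adjM (A *m B) = adjM B *m adjM A.
Proof. by rewrite /adjM trmx_mul map_mxM. Qed.

Lemma adjMK p q (A : 'M[R[i]]_(p, q)) : adjM (adjM A) = A.
Proof. by apply/matrixP => a b; rewrite !adjME conjCK. Qed.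

Lemma adjM1 n : adjM 1%:M = 1%:M :> 'M[R[i]]_n.
Proof. by rewrite /adjM trmx1 map_mx1. Qed.

Lemma adjM_delta n (k l : 'I_n) :
  adjM (delta_mx k l) = delta_mx l k :> 'M[R[i]]_n.
Proof. by apply/matrixP => a b; rewrite adjME !mxE conjC_nat andbC. Qed.

Lemma unitary_adjMr n (a : 'M[R[i]]_n) : a \is unitarymx -> a *m adjM a = 1%:M.
Proof. by move/unitarymxP. Qed.

Lemma unitary_adjMl n (a : 'M[R[i]]_n) : a \is unitarymx -> adjM a *m a = 1%:M.
Proof. by move/unitary_adjMr/mulmx1C. Qed.

Lemma adjM_unitary n (a : 'M[R[i]]_n) :
  (adjM a \is unitarymx) = (a \is unitarymx).
Proof. by rewrite trmxC_unitary. Qed.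

Lemma unitary1 n : (1%:M : 'M[R[i]]_n) \is unitarymx.
Proof. by apply/unitarymxP; rewrite mul1mx -/(adjM _) adjM1. Qed.

Lemma unitary_conj n (a b : 'M[R[i]]_n) : a \is unitarymx ->
  b \is unitarymx -> a *m b *m adjM a \is unitarymx.
Proof.
move=> ua ub; apply/unitarymxP; rewrite -/(adjM _) !adjM_mul adjMK -!mulmxA.
by rewrite (mulmxA (adjM a) a) unitary_adjMl // mul1mx (mulmxA b)
  unitary_adjMr // mul1mx unitary_adjMr. Qed.

End Adjoint.

Section ComplexDerivative.
Variable R : realType.
Implicit Types (F G : R -> R[i]) (x y : R[i]).

Definition cderiv0 F x :=
  is_derive (0 : R) (1 : R) (fun t => complex.Re (F t)) (complex.Re x) /\
  is_derive (0 : R) (1 : R) (fun t => complex.Im (F t)) (complex.Im x).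

Lemma cderiv0_unique F x y : cderiv0 F x -> cderiv0 F y -> x = y.
Proof.
move=> [[_ hx1] [_ hx2]] [[_ hy1] [_ hy2]].
by apply: complexP; [rewrite -hx1 -hy1|rewrite -hx2 -hy2].
Qed.

Lemma eq_cderiv0 F G x y : F =1 G -> x = y -> cderiv0 F x -> cderiv0 G y.
Proof. by move=> /funext -> ->. Qed.

Lemma cderiv0_cst x : cderiv0 (fun=> x) 0.
Proof. by split; exact: is_derive_cst. Qed.

Lemma cderiv0D F G x y :
  cderiv0 F x -> cderiv0 G y -> cderiv0 (fun t => F t + G t) (x + y).
Proof.
move=> [h1 h2] [h3 h4]; split.
  rewrite ReCD (_ : (fun t => _) = (fun t => complex.Re (F t)) +
    (fun t => complex.Re (G t))); first exact: is_deriveD.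
  by apply/funext => t; rewrite ReCD.
rewrite ImCD (_ : (fun t => _) = (fun t => complex.Im (F t)) +
  (fun t => complex.Im (G t))); first exact: is_deriveD.
by apply/funext => t; rewrite ImCD.
Qed.

Lemma cderiv0M F G x y : cderiv0 F x -> cderiv0 G y ->
  cderiv0 (fun t => F t * G t) (x * G 0 + F 0 * y).
Proof.
move=> [h1 h2] [h3 h4]; split.
  have e : (fun t => complex.Re (F t * G t)) =
      (fun t => complex.Re (F t)) * (fun t => complex.Re (G t)) -
      (fun t => complex.Im (F t)) * (fun t => complex.Im (G t)).
    by apply/funext => t; rewrite ReCM.
  rewrite e.
  apply: (is_derive_eq (is_deriveB (is_deriveM h1 h3) (is_deriveM h2 h4))).
  by rewrite !ReImE /GRing.scale /=; ring.
have e : (fun t => complex.Im (F t * G t)) =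
    (fun t => complex.Re (F t)) * (fun t => complex.Im (G t)) +
    (fun t => complex.Im (F t)) * (fun t => complex.Re (G t)).
  by apply/funext => t; rewrite ImCM.
rewrite e.
apply: (is_derive_eq (is_deriveD (is_deriveM h1 h4) (is_deriveM h2 h3))).
by rewrite !ReImE /GRing.scale /=; ring.
Qed.

Lemma cderiv0J F x :
  cderiv0 F x -> cderiv0 (fun t => Num.conj (F t)) (Num.conj x).
Proof.
move=> [h1 h2]; split.
  rewrite ReCJ (_ : (fun t => _) = (fun t => complex.Re (F t))) //.
  by apply/funext => t; rewrite ReCJ.
rewrite ImCJ (_ : (fun t => _) = - (fun t => complex.Im (F t))).
  exact: is_deriveN.
by apply/funext => t; rewrite ImCJ.
Qed.

Lemma cderiv0_sum (I : finType) (F : I -> R -> R[i]) (x : I -> R[i]) :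
  (forall i, cderiv0 (F i) (x i)) ->
  cderiv0 (fun t => \sum_i F i t) (\sum_i x i).
Proof.
move=> h; elim: (index_enum I) => [|i s IH].
  rewrite big_nil (_ : (fun t => _) = (fun=> 0)); first exact: cderiv0_cst.
  by apply/funext => t; rewrite big_nil.
rewrite big_cons (_ : (fun t => _) = (fun t => F i t + \sum_(i <- s) F i t)).
  exact: cderiv0D.
by apply/funext => t; rewrite big_cons.
Qed.

Lemma cderiv0_real (f : R -> R) (d : R) :
  is_derive (0 : R) (1 : R) f d -> cderiv0 (fun t => ((f t)%:C)%C) (d%:C)%C.
Proof. by move=> h; split => //=; exact: is_derive_cst. Qed.

Lemma curve_deriv0_unique p q (c : R -> 'M[R[i]]_(p, q)) A B :
  curve_deriv0 c A -> curve_deriv0 c B -> A = B.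
Proof.
move=> h1 h2; apply/matrixP => a b.
exact: (@cderiv0_unique (fun t => c t a b) _ _ (h1 a b) (h2 a b)).
Qed.

Lemma curve_deriv0_cst p q (A : 'M[R[i]]_(p, q)) : curve_deriv0 (fun=> A) 0.
Proof. by move=> a b; rewrite mxE; exact: (cderiv0_cst (A a b)). Qed.

Lemma eq_curve_deriv0 p q (c d : R -> 'M[R[i]]_(p, q)) A B :
  c =1 d -> A = B -> curve_deriv0 c A -> curve_deriv0 d B.
Proof. by move=> /funext -> ->. Qed.

Lemma curve_deriv0_mulmx p q r (c : R -> 'M[R[i]]_(p, q))
    (d : R -> 'M[R[i]]_(q, r)) A B :
  curve_deriv0 c A -> curve_deriv0 d B ->
  curve_deriv0 (fun t => c t *m d t) (A *m d 0 + c 0 *m B).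
Proof.
move=> h1 h2 a b.
have h k : cderiv0 (fun t => c t a k * d t k b)
    (A a k * d 0 k b + c 0 a k * B k b).
  exact: (cderiv0M (h1 a k) (h2 k b)).
apply: eq_cderiv0 (cderiv0_sum h) => [t|]; first by rewrite mxE.
by rewrite !mxE big_split.
Qed.

Lemma curve_deriv0_adjM p q (c : R -> 'M[R[i]]_(p, q)) A :
  curve_deriv0 c A -> curve_deriv0 (fun t => adjM (c t)) (adjM A).
Proof.
move=> h a b; by apply: eq_cderiv0 (cderiv0J (h b a)) => [t|]; rewrite adjME.
Qed.

Lemma curve_deriv0_linear p q r s
    (L : {linear 'M[R[i]]_(p, q) -> 'M[R[i]]_(r, s)})
    (c : R -> 'M[R[i]]_(p, q)) A :
  curve_deriv0 c A -> curve_deriv0 (fun t => L (c t)) (L A).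
Proof.
move=> h a b.
have LE X : L X a b =
    \sum_(k : 'I_p * 'I_q) X k.1 k.2 * L (delta_mx k.1 k.2) a b.
  rewrite [X in L X]matrix_sum_delta pair_bigA /= linear_sum summxE.
  by apply: eq_bigr => k _; rewrite linearZ mxE.
have hk k : cderiv0 (fun t => c t k.1 k.2 * L (delta_mx k.1 k.2) a b)
    (A k.1 k.2 * L (delta_mx k.1 k.2) a b + c 0 k.1 k.2 * 0).
  exact: (cderiv0M (h k.1 k.2) (cderiv0_cst _)).
apply: eq_cderiv0 (cderiv0_sum hk) => [t|]; first by rewrite LE.
by rewrite LE; apply: eq_bigr => k _; rewrite mulr0 addr0.
Qed.

End ComplexDerivative.

(** * The differential of a unitary representation *)

Section SkewCubic.
Variables (R : realType) (n : nat).
Implicit Types A : 'M[R[i]]_n.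

(* These matrices span gl(n, C), and their one-parameter groups are quadratic *)
(* polynomials in A.                                                          *)
Definition skew_cubic A := adjM A = - A /\ A *m A *m A = - A.

(* The curve is [exp (t A) = 1 + sin t A + (1 - cos t) A^2]. *)
Lemma skew_cubic_curve A : skew_cubic A ->
  exists c : R -> 'M[R[i]]_n,
    [/\ forall t, c t \is unitarymx, c 0 = 1%:M & curve_deriv0 c A].
Proof.
move=> [skA cubA].
pose c (t : R) : 'M[R[i]]_n :=
  1%:M + (((sin t)%:C)%C *: A + ((1 - cos t)%:C)%C *: (A *m A)).
exists c; split.
- move=> t; apply/unitarymxP; rewrite -/(adjM _).
  have -> : adjM (c t) =
      1%:M + (- ((sin t)%:C)%C *: A + ((1 - cos t)%:C)%C *: (A *m A)).
    rewrite /c !adjMD adjM1 !adjMZ adjM_mul skA !conj_real mulNmx mulmxN opprK.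
    by rewrite scalerN scaleNr.
  (* As A^3 = - A, the product of [c t] with its adjoint is 1 + (2 u - s^2 - u^2) A^2; the
     coefficient vanishes for s = sin t and u = 1 - cos t. *)
  rewrite /c; set s : R[i] := ((sin t)%:C)%C.
  have := cos2Dsin2 t.
  set x := cos t => e.
  have {e} e : (s * s = ((1 - x ^+ 2)%:C)%C)%R.
    rewrite -e /s; apply: complexP; rewrite !ReImE /=; ring.
  set u : R[i] := ((1 - x)%:C)%C.
  have {e} e : u + u - s * s - u * u = 0.
    by rewrite e; apply: complexP; rewrite !ReImE /=; ring.
  rewrite !(mulmxDl, mulmxDr, mul1mx, mulmx1) -!scalemxAl -!scalemxAr.
  rewrite !mulmxA cubA !mulNmx !scalerN !scaleNr.
  rewrite !scalerN !scalerA; move: (A *m A) => S.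
  apply/eqP; rewrite -subr_eq0; apply/eqP/matrixP => a b; rewrite !mxE.
  transitivity ((u + u - s * s - u * u) * S a b); last by rewrite e mul0r.
  ring.
- by rewrite /c sin0 cos0 subrr !scale0r !addr0.
- move=> a b.
  have ds := cderiv0_real (is_derive_sin (0 : R)).
  have d1c : is_derive (0 : R) (1 : R) (fun t : R => 1 - cos t) (0 - - sin 0).
    have h := is_deriveB (is_derive_cst (1 : R) (0 : R) (1 : R))
      (is_derive_cos (0 : R)).
    exact: h.
  have dc := cderiv0_real d1c.
  have h := cderiv0D (cderiv0_cst ((1%:M : 'M[R[i]]_n) a b))
    (cderiv0D (cderiv0M ds (cderiv0_cst (A a b)))
              (cderiv0M dc (cderiv0_cst ((A *m A) a b)))).
  apply: eq_cderiv0 h => [t|].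
    by rewrite /c; move: (A *m A) => S; rewrite !mxE.
  rewrite sin0 cos0 opprK addr0 !mulr0 !addr0 add0r.
  by rewrite [(0%:C)%C](_ : _ = 0) // mul0r addr0 mul1r.
Qed.

Lemma skew_cubic_diag (k : 'I_n) : skew_cubic ('i *: delta_mx k k).
Proof.
split; first by rewrite adjMZ adjM_delta conjCi scaleNr.
rewrite -!(scalemxAl, scalemxAr) !mul_delta_mx !scalerA -expr2 sqrCi.
by rewrite mulN1r scaleNr.
Qed.

(** Up to a factor i the matrices are X + e Y with X = E_kl, Y = E_lk, e = -1 or 1. Since X and Y
    have square zero, X Y X = X and Y X Y = Y, the cube is e (X + e Y); for e = 1 the missing sign
    comes from i^3 = - i. *)
Lemma skew_cubic_off (k l : 'I_n) : k != l ->
  skew_cubic (delta_mx k l - delta_mx l k) /\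
  skew_cubic ('i *: (delta_mx k l + delta_mx l k)).
Proof.
move=> kl; have lk : l != k by rewrite eq_sym.
have cubeE (X Y : 'M[R[i]]_n) (e : R[i]) : X *m X = 0 -> Y *m Y = 0 ->
    X *m Y *m X = X -> Y *m X *m Y = Y -> e * e = 1 ->
    (X + e *: Y) *m (X + e *: Y) *m (X + e *: Y) = e *: (X + e *: Y).
  move=> XX YY XYX YXY ee.
  have -> : (X + e *: Y) *m (X + e *: Y) = e *: (X *m Y + Y *m X).
    rewrite mulmxDl mulmxDr XX add0r mulmxDr -!scalemxAl -!scalemxAr YY.
    by rewrite !scaler0 addr0 scalerDr.
  rewrite -scalemxAl mulmxDl !mulmxDr XYX -!scalemxAr YXY.
  by rewrite -!mulmxA XX YY !mulmx0 scaler0 addr0 add0r.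
have sqr (e : R[i]) : e * e = 1 -> (delta_mx k l + e *: delta_mx l k)
    *m (delta_mx k l + e *: delta_mx l k) *m (delta_mx k l + e *: delta_mx l k)
    = e *: (delta_mx k l + e *: delta_mx l k).
  by apply: cubeE; rewrite ?mul_delta_mx ?mul_delta_mx_0 // ?mul_delta_mx.
split; split.
- by rewrite adjMD adjMN !adjM_delta opprB addrC.
- have := sqr (-1); rewrite mulrNN mulr1 => /(_ erefl).
  by rewrite !scaleN1r.
- by rewrite adjMZ adjMD !adjM_delta conjCi scaleNr addrC.
- have := sqr 1; rewrite mulr1 => /(_ erefl); rewrite !scale1r => e.
  rewrite -!(scalemxAl, scalemxAr) !scalerA e -expr2 sqrCi.
  by rewrite mulN1r scaleNr.
Qed.

(** Every matrix unit is a complex combination of skew-cubic matrices. So a complex-linear identity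
    about dpi need only be checked at velocities of unitary curves, where it follows by
    differentiating an identity of the group. *)
Lemma skew_cubic_ext (V : lmodType R[i]) (F : 'M[R[i]]_n -> V) : linear F ->
  (forall A, skew_cubic A -> F A = 0) -> forall A, F A = 0.
Proof.
move=> linF F0 A.
have FD := linear_propD linF; have FZ := linear_propZ linF.
have FE k l : F (delta_mx k l) = 0.
  have [<-|kl] := eqVneq k l.
    rewrite -[delta_mx k k]scale1r -[1]opprK -sqrCi expr2 -mulNr -scalerA FZ.
    by rewrite F0 ?scaler0 //; exact: skew_cubic_diag.
  have [s1 s2] := skew_cubic_off kl.
  have -> : delta_mx k l = 2^-1 *: ((delta_mx k l - delta_mx l k)
      + (- 'i) *: ('i *: (delta_mx k l + delta_mx l k))) :> 'M[R[i]]_n.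
    rewrite scalerA mulNr -expr2 sqrCi opprK scale1r addrACA addNr addr0.
    by move: (delta_mx k l) => X; apply/matrixP => a b; rewrite !mxE; field.
  by rewrite FZ FD FZ !F0 // scaler0 addr0 scaler0.
rewrite [A]matrix_sum_delta (linear_prop_sum linF) big1 // => k _.
by rewrite (linear_prop_sum linF) big1 // => l _; rewrite FZ FE scaler0.
Qed.

End SkewCubic.

Section RepresentationDifferential.
Variables (R : realType) (m N : nat) (pi : unitary_rep R m N).
Local Notation dpi := (rep_diff pi).
Implicit Types (a A B : 'M[R[i]]_m).

Lemma rep1 : pi 1%:M = 1%:M.
Proof.
have u1 := unitary1 R m; have := rep_mul pi u1 u1; rewrite mulmx1 => e.
have up := rep_unitary pi u1.
have := congr1 (mulmxr (adjM (pi 1%:M))) e.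
by rewrite /= -mulmxA unitary_adjMr // mulmx1 => <-.
Qed.

Lemma rep_adjM a : a \is unitarymx -> pi (adjM a) = adjM (pi a).
Proof.
move=> ua; have ua' : adjM a \is unitarymx by rewrite adjM_unitary.
have upi := rep_unitary pi ua.
rewrite -[LHS]mulmx1 -(unitary_adjMr upi) mulmxA -(rep_mul pi ua' ua).
rewrite (unitary_adjMl ua).
by rewrite rep1 mul1mx.
Qed.

(** Both sides are the velocity of [pi (a *m c t *m adjM a)], once by [rep_diffP] for the conjugated
    curve and once by multiplicativity of pi. *)
Lemma rep_diff_conj a A : a \is unitarymx ->
  dpi (a *m A *m adjM a) = pi a *m dpi A *m adjM (pi a).
Proof.
move=> ua.
pose F A := dpi (a *m A *m adjM a) - pi a *m dpi A *m adjM (pi a).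
suff F0 : F A = 0 by apply/eqP; rewrite -subr_eq0; apply/eqP.
apply: (skew_cubic_ext (F := F)) => [z X Y|{}A sA].
  rewrite /F mulmxDr mulmxDl -scalemxAr -scalemxAl 2!linearP.
  rewrite mulmxDr mulmxDl -scalemxAr -scalemxAl scalerBr opprD.
  by rewrite addrACA.
have [c [uc c0 dc]] := skew_cubic_curve sA.
have u1 t : a *m c t *m adjM a \is unitarymx := unitary_conj ua (uc t).
have d1 : curve_deriv0 (fun t => a *m c t *m adjM a) (a *m A *m adjM a).
  have := curve_deriv0_mulmx (curve_deriv0_mulmx (curve_deriv0_cst a) dc)
    (curve_deriv0_cst (adjM a)).
  by rewrite mul0mx mulmx0 add0r addr0.
have d2 := rep_diffP pi u1 _ d1.
have d3 := curve_deriv0_mulmx (curve_deriv0_mulmx (curve_deriv0_cst (pi a))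
  (rep_diffP pi uc c0 dc)) (curve_deriv0_cst (adjM (pi a))).
rewrite mul0mx mulmx0 add0r addr0 in d3.
apply/eqP; rewrite subr_eq0; apply/eqP.
apply: curve_deriv0_unique (d2 _) _.
  by rewrite c0 mulmx1 (unitary_adjMr ua).
apply: eq_curve_deriv0 d3 => // t /=.
have ua' : adjM a \is unitarymx by rewrite adjM_unitary.
rewrite (rep_mul pi (mul_unitarymx ua (uc t)) ua') (rep_mul pi ua (uc t)).
by rewrite (rep_adjM ua).
Qed.

(** Differentiating the unitarity of [pi (c t)] shows that dpi A is skew-Hermitian when A is
    skew-cubic. Taking the outer adjoint in F makes the difference complex-linear rather than
    antilinear in A. *)
Lemma rep_diff_adjM A : dpi (adjM A) = adjM (dpi A).
Proof.
pose F A := adjM (dpi (adjM A)) - dpi A.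
suff F0 : F A = 0.
  by rewrite -[LHS]adjMK; congr adjM; apply/eqP; rewrite -subr_eq0; apply/eqP.
apply: (skew_cubic_ext (F := F)) => [z X Y|{}A sA].
  rewrite /F adjM_is_semilinear 2!linearP adjM_is_semilinear conjCK.
  by rewrite scalerBr opprD addrACA.
have [c [uc c0 dc]] := skew_cubic_curve sA.
have dp := rep_diffP pi uc c0 dc.
have := curve_deriv0_mulmx dp (curve_deriv0_adjM dp).
rewrite /= c0 rep1 adjM1 mulmx1 mul1mx => d1.
have d2 : curve_deriv0 (fun t => pi (c t) *m adjM (pi (c t))) 0.
  apply: eq_curve_deriv0 (curve_deriv0_cst 1%:M) => // t.
  by rewrite (unitary_adjMr (rep_unitary pi (uc t))).
case: sA => sA _; have := curve_deriv0_unique d1 d2.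
by rewrite /F sA linearN adjMN => e; rewrite -opprD addrC e oppr0.
Qed.

(** This is the derivative of the equivariance [rep_diff_conj] along a unitary curve with velocity
    A, with B fixed. *)
Lemma rep_diff_bracket A B :
  dpi (A *m B - B *m A) = dpi A *m dpi B - dpi B *m dpi A.
Proof.
pose F A := dpi (A *m B - B *m A) - (dpi A *m dpi B - dpi B *m dpi A).
suff F0 : F A = 0 by apply/eqP; rewrite -subr_eq0; apply/eqP.
apply: (skew_cubic_ext (F := F)) => [z X Y|{}A sA].
  rewrite /F mulmxDl mulmxDr -scalemxAr -scalemxAl opprD addrACA -scalerBr.
  rewrite 2!linearP mulmxDl mulmxDr -scalemxAr -scalemxAl.
  move: (dpi _) (dpi (_ - _)) (dpi X *m _) (dpi Y *m _)
    (_ *m dpi X) (_ *m dpi Y).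
  by move=> ? ? ? ? ? ?; apply/matrixP => i j; rewrite !mxE; ring.
have [c [uc c0 dc]] := skew_cubic_curve sA.
have dp := rep_diffP pi uc c0 dc.
have d1 := curve_deriv0_mulmx (curve_deriv0_mulmx dc (curve_deriv0_cst B))
  (curve_deriv0_adjM dc).
have d2 := curve_deriv0_mulmx (curve_deriv0_mulmx dp
  (curve_deriv0_cst (dpi B))) (curve_deriv0_adjM dp).
move: sA => [sA _].
rewrite c0 adjM1 !mul1mx mulmx1 addr0 sA mulmxN in d1.
rewrite /= c0 rep1 adjM1 !mul1mx mulmx1 addr0 in d2.
rewrite -rep_diff_adjM sA linearN mulmxN in d2.
apply/eqP; rewrite subr_eq0; apply/eqP.
apply: curve_deriv0_unique (curve_deriv0_linear _ d1) _.
apply: eq_curve_deriv0 d2 => // t /=.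
by rewrite (rep_diff_conj _ (uc t)).
Qed.

End RepresentationDifferential.

(** * Casimir operators *)

Lemma mulmx_delta_mul (K : comPzRingType) n k l p
    (X : 'M[K]_(n, k)) (Y : 'M[K]_(l, p)) i j r s :
  (X *m delta_mx i j *m Y) r s = X r i * Y j s.
Proof.
rewrite mxE (bigD1 j) //= big1 ?addr0 => [|b bj].
  rewrite mxE (bigD1 i) //= big1 ?addr0 => [|b bi]; rewrite mxE.
    by rewrite !eqxx mulr1.
  by rewrite (negPf bi) mulr0.
by rewrite mxE big1 ?mul0r // => b' _; rewrite mxE (negPf bj) andbF mulr0.
Qed.

Section Casimir.
Variables (R : realType) (m : nat) (V : vectType R[i]).
Variables (act dact : 'M[R[i]]_m -> V -> V).
Implicit Types (a A B : 'M[R[i]]_m) (v : V) (la : weight m).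

(* The kernel of [F - c] in W is invariant and contains the highest weight    *)
(* vector.                                                                    *)
Lemma irreducible_hw_scalar la (W : {vspace V}) (F : V -> V) (c : R[i]) :
  (forall a, linear (act a)) -> linear F ->
  (forall a v, a \is unitarymx -> F (act a v) = act a (F v)) ->
  (forall v, highest_weight_vector dact la v -> F v = c *: v) ->
  irreducible_hw act dact la W -> forall v, v \in W -> F v = c *: v.
Proof.
move=> linA linF comF hwF [[W0 invW irrW] [v vW hv]].
pose G v := F v - c *: v.
have linG : linear G.
  move=> z x y; rewrite /G linF scalerDr scalerBr !scalerA [z * c]mulrC.
  by rewrite opprD addrACA.
pose Gl : {linear V -> V} :=
  HB.pack G (GRing.isLinear.Build R[i] V V *:%R G linG).
pose U := (W :&: lker (linfun Gl))%VS.
have memU x : (x \in U) = (x \in W) && (G x == 0).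
  by rewrite memv_cap memv_ker lfunE.
have [||U0|UW] := irrW U; first exact: capvSl.
- move=> a x ua; rewrite !memU => /andP[xW /eqP Gx].
  rewrite invW //= /G comF //; apply/eqP.
  rewrite -(linear_propZ (linA a)); move/eqP: Gx.
  by rewrite subr_eq0 => /eqP ->; rewrite subrr.
- have : v \in U by rewrite memU vW /G hwF // subrr eqxx.
  by rewrite U0 memv0 => /eqP v0; case: hv => -[]; rewrite v0 eqxx.
- move=> x; rewrite -UW memU => /andP[_]; rewrite subr_eq0 => /eqP. exact.
Qed.

(** These are the properties that the quadratic Casimir argument uses; V, V (x) C^m and V (x)
    conj(C^m) all have them, so the argument is made once. *)
Record gl_action : Prop := GlAction {
  act_linear : forall a, linear (act a);
  dact_linearl : forall v, linear (dact^~ v);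
  dact_linear : forall A, linear (dact A);
  act_dact : forall a A v, a \is unitarymx ->
    act a (dact A v) = dact (a *m A *m adjM a) (act a v);
  dact_bracket : forall A B v,
    dact (A *m B - B *m A) v = dact A (dact B v) - dact B (dact A v) }.

Definition casimir2 v : V :=
  \sum_p \sum_q dact (delta_mx p q) (dact (delta_mx q p) v).

(** The (p, q) term is the eigenvalue of E_pq E_qp on a highest weight vector: for p < q it is that
    of the bracket E_pp - E_qq, and for p > q the factor E_qp already kills the vector. *)
Definition casimir2_value la : int :=
  \sum_p \sum_q if p == q then la p * la p else
                if (p < q)%N then la p - la q else 0.

Hypothesis glV : gl_action.

Lemma casimir2_linear : linear casimir2.
Proof.
move=> z x y; rewrite /casimir2 scaler_sumr -big_split; apply: eq_bigr => p _.
rewrite scaler_sumr -big_split; apply: eq_bigr => q _.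
by rewrite !dact_linear.
Qed.

(** The tensor sum_pq E_pq (x) E_qp is dual to the trace form, which conjugation preserves. *)
Lemma bilinear_trace_form (U : lmodType R[i])
    (f : 'M[R[i]]_m -> 'M[R[i]]_m -> U) a :
  (forall A, linear (f A)) -> (forall A, linear (f^~ A)) -> a \is unitarymx ->
  \sum_p \sum_q f (a *m delta_mx p q *m adjM a) (a *m delta_mx q p *m adjM a) =
  \sum_p \sum_q f (delta_mx p q) (delta_mx q p).
Proof.
move=> fr fl ua.
have conjE p q : a *m delta_mx p q *m adjM a =
    \sum_r \sum_s (a r p * Num.conj (a s q)) *: delta_mx r s.
  rewrite [LHS]matrix_sum_delta; apply: eq_bigr => r _; apply: eq_bigr => s _.
  by rewrite mulmx_delta_mul adjME.
under eq_bigr => p _ do under eq_bigr => q _ do rewrite {1}conjE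
  (linear_prop_sum (fl _)).
under eq_bigr => p _ do under eq_bigr => q _ do under eq_bigr => r _ do
  rewrite (linear_prop_sum (fl _)).
under eq_bigr => p _ do rewrite exchange_big /=.
rewrite exchange_big /=; apply: eq_bigr => r _.
under eq_bigr => p _ do rewrite exchange_big /=.
rewrite exchange_big /=; apply: eq_bigr => s _.
(* The coefficients of E_rs, moved to the second argument, assemble to
   [adjM a *m delta_mx s r *m a], and the outer conjugation undoes this one. *)
transitivity (f (delta_mx r s) (a *m (adjM a *m delta_mx s r *m a) *m adjM a)).
  have -> : adjM a *m delta_mx s r *m a =
      \sum_p \sum_q (a r p * Num.conj (a s q)) *: delta_mx q p.
    rewrite [LHS]matrix_sum_delta exchange_big; apply: eq_bigr => p _.
    by apply: eq_bigr => q _; rewrite mulmx_delta_mul adjME mulrC.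
  rewrite mulmx_sumr mulmx_suml (linear_prop_sum (fr _)).
  apply: eq_bigr => p _.
  rewrite mulmx_sumr mulmx_suml (linear_prop_sum (fr _)).
  apply: eq_bigr => q _.
  by rewrite (linear_propZ (fl _)) -scalemxAr -scalemxAl (linear_propZ (fr _)).
by rewrite !mulmxA (unitary_adjMr ua) mul1mx -mulmxA (unitary_adjMr ua) mulmx1.
Qed.

Lemma casimir2_act a v : a \is unitarymx ->
  casimir2 (act a v) = act a (casimir2 v).
Proof.
move=> ua; rewrite /casimir2 (linear_prop_sum (act_linear glV a)).
under [RHS]eq_bigr => p _ do rewrite (linear_prop_sum (act_linear glV a)).
under [RHS]eq_bigr => p _ do under eq_bigr => q _ do
  rewrite (act_dact glV _ _ ua) (act_dact glV _ _ ua).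
pose f A B := dact A (dact B (act a v)).
apply/esym/(bilinear_trace_form (f := f)) => // [A z x y|A z x y].
  by rewrite /f (dact_linearl glV) (dact_linear glV).
by rewrite /f (dact_linearl glV).
Qed.

Lemma casimir2_hwv la v : highest_weight_vector dact la v ->
  casimir2 v = (casimir2_value la)%:~R *: v.
Proof.
move=> [[_ wv] hv].
rewrite /casimir2_value raddf_sum scaler_suml; apply: eq_bigr => p _.
rewrite raddf_sum scaler_suml; apply: eq_bigr => q _.
have dZ A z := linear_propZ (dact_linear glV A) z v.
have [<-|pq] := eqVneq p q.
  by rewrite wv dZ wv scalerA -rmorphM.
case: ltnP => [ltpq|leqp].
  have := dact_bracket glV (delta_mx p q) (delta_mx q p) v.
  rewrite !mul_delta_mx (hv _ _ ltpq) (linear_prop0 (dact_linear glV _)) subr0.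
  move=> <-; rewrite -scaleN1r addrC (dact_linearl glV) !wv.
  by rewrite scaleN1r addrC -scalerBl -rmorphB.
rewrite hv ?(linear_prop0 (dact_linear glV _)) ?scale0r //.
by rewrite ltn_neqAle leqp andbT; apply: contraNneq pq => /val_inj ->.
Qed.

Lemma casimir2_scalar la (W : {vspace V}) v : irreducible_hw act dact la W ->
  v \in W -> casimir2 v = (casimir2_value la)%:~R *: v.
Proof.
move=> irW; apply: (irreducible_hw_scalar _ _ _ _ irW).
- exact: act_linear.
- exact: casimir2_linear.
- exact: casimir2_act.
- exact: casimir2_hwv.
Qed.

End Casimir.

Section CasimirValue.
Variable m : nat.
Implicit Types (la rho : weight m) (k : 'I_m).

Lemma sum_ord_gtn n (p : nat) : (\sum_(q < n) (p < q)%N)%N = (n - p.+1)%N.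
Proof. by elim: n => [|n IH]; rewrite ?big_ord0 // big_ord_recr /= IH; lia. Qed.

Lemma sum_ord_ltn n (p : nat) : (\sum_(q < n) (q < p)%N)%N = minn p n.
Proof.
elim: n => [|n IH]; first by rewrite big_ord0 minn0.
by rewrite big_ord_recr /= IH; lia.
Qed.

(** An index p, counted from 0, is the smaller member of m - 1 - p pairs and the larger member of p
    pairs. The result is the usual product of la with la + 2 delta, where 2 delta is the sum of the
    positive roots. *)
Lemma casimir2_valueE la :
  casimir2_value la = \sum_p la p * (la p + (m%:Z - 1 - 2 * p%:Z)).
Proof.
rewrite /casimir2_value.
have split2 (p q : 'I_m) :
    (if p == q then la p * la p else if (p < q)%N then la p - la q else 0)
    = (if q == p then la p * la p else 0) + (la p * (p < q)%N%:Z)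
      - la q * (p < q)%N%:Z.
  rewrite eq_sym; have [->|pq] := eqVneq q p; first by rewrite ltnn; lia.
  by case: (p < q)%N; lia.
under eq_bigr => p _ do under eq_bigr => q _ do rewrite split2.
under eq_bigr => p _ do rewrite sumrB big_split /= -big_mkcond big_pred1_eq
  -mulr_sumr -[\sum_i _%:Z]raddf_sum sum_ord_gtn.
rewrite sumrB [X in _ - X]exchange_big /= -sumrB; apply: eq_bigr => p _.
rewrite -mulr_sumr -[\sum_i _%:Z]raddf_sum sum_ord_ltn /=.
have := ltn_ord p; move: (la p) => x pm.
have -> : ((m - p.+1)%N%:Z : int) = m%:Z - 1 - p%:Z by lia.
have -> : minn p m = p by lia.
ring.
Qed.

(** Only the k-th term changes. The increment is m, the Casimir value of C^m, plus twice
    [rho k - k], which is - [w_plus rho k] because k counts from 0. *)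
Lemma casimir2_value_addmu rho k :
  casimir2_value (fun j => rho j + mu k j) =
  casimir2_value rho + 2 * (rho k - k%:Z) + m%:Z.
Proof.
rewrite !casimir2_valueE (bigD1 k) //= [X in _ = X + _ + _](bigD1 k) //=.
rewrite /mu eqxx [true%:Z](_ : _ = 1) //.
under eq_bigr => p pk do rewrite (negPf pk) addr0.
ring.
Qed.

Lemma casimir2_value_submu rho k :
  casimir2_value (fun j => rho j - mu k j) =
  casimir2_value rho - 2 * w_minus rho k + m%:Z.
Proof.
rewrite !casimir2_valueE (bigD1 k) //= [X in _ = X - _ + _](bigD1 k) //=.
rewrite /mu /w_minus eqxx [true%:Z](_ : _ = 1) // -[k.+1]addn1 PoszD.
under eq_bigr => p pk do rewrite (negPf pk) subr0.
ring.
Qed.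

End CasimirValue.

(** * Tensor products with C^m and its conjugate *)

Section TensorActions.
Variables (R : realType) (m N : nat) (pi : unitary_rep R m N).
Local Notation dpi := (rep_diff pi).
Implicit Types (a A B : 'M[R[i]]_m) (X Y : 'M[R[i]]_(N, m)).

Lemma rep_diff_conjr a A : a \is unitarymx ->
  pi a *m dpi A = dpi (a *m A *m adjM a) *m pi a.
Proof.
move=> ua; rewrite (rep_diff_conj _ _ ua) -mulmxA.
by rewrite (unitary_adjMl (rep_unitary pi ua)) mulmx1.
Qed.

Lemma gl_action_rep : gl_action (ract pi) (rdact pi).
Proof.
split=> [a z x y|v z x y|A z x y|a A v ua|A B v].
- by rewrite /ract mulmxDr scalemxAr.
- by rewrite /rdact linearP mulmxDl scalemxAl.
- by rewrite /rdact mulmxDr scalemxAr.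
- by rewrite /ract /rdact !mulmxA (rep_diff_conjr _ ua).
- by rewrite /rdact rep_diff_bracket mulmxBl !mulmxA.
Qed.

Lemma gl_action_tens : gl_action (tens pi) (dtens pi).
Proof.
split=> [a z x y|v z x y|A z x y|a A v ua|A B v].
- by rewrite /tens mulmxDr mulmxDl -scalemxAr -scalemxAl.
- rewrite /dtens linearP mulmxDl -scalemxAl linearP mulmxDr -scalemxAr.
  by rewrite scalerDr addrACA.
- by rewrite /dtens mulmxDr mulmxDl -scalemxAr -scalemxAl scalerDr addrACA.
- rewrite /tens /dtens mulmxDr mulmxDl !mulmxA (rep_diff_conjr _ ua).
  congr (_ + _); rewrite !trmx_mul -!mulmxA; congr (_ *m (_ *m _)).
  by rewrite (mulmxA a^T) -[a^T *m _]trmx_mul (unitary_adjMl ua) trmx1 mul1mx.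
- rewrite /dtens rep_diff_bracket linearB /= !trmx_mul mulmxBl mulmxBr.
  rewrite !(mulmxDl, mulmxDr) !mulmxA.
  move: (_ *m B^T *m A^T) (_ *m A^T *m B^T) (_ *m _ *m A^T) (_ *m _ *m B^T).
  move: (_ *m dpi B *m v) (_ *m dpi A *m v) => ? ? ? ? ? ?.
  by apply/matrixP => i j; rewrite !mxE; ring.
Qed.

Lemma gl_action_ctens : gl_action (ctens pi) (dctens pi).
Proof.
split=> [a z x y|v z x y|A z x y|a A v ua|A B v].
- by rewrite /ctens mulmxDr mulmxDl -scalemxAr -scalemxAl.
- rewrite /dctens linearP mulmxDl -scalemxAl mulmxDr -scalemxAr opprD.
  by rewrite scalerBr addrACA.
- rewrite /dctens mulmxDr mulmxDl -scalemxAr -scalemxAl scalerBr opprD.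
  by rewrite addrACA.
- rewrite /ctens /dctens mulmxBr mulmxBl !mulmxA (rep_diff_conjr _ ua).
  congr (_ - _); rewrite -!mulmxA; congr (_ *m (_ *m _)).
  by rewrite !mulmxA (unitary_adjMl ua) mul1mx.
- rewrite /dctens rep_diff_bracket mulmxBl mulmxBr.
  rewrite !(mulmxBl, mulmxBr) !mulmxA.
  move: (v *m B *m A) (v *m A *m B) (_ *m v *m A) (_ *m v *m B).
  move: (_ *m dpi B *m v) (_ *m dpi A *m v) => ? ? ? ? ? ?.
  by apply/matrixP => i j; rewrite !mxE; ring.
Qed.

End TensorActions.

Lemma sum_delta_diag (K : nzRingType) n :
  \sum_p delta_mx p p = 1%:M :> 'M[K]_n.
Proof.
apply/matrixP => i j; rewrite summxE !mxE (bigD1 i) //= big1 => [|k ki].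
  by rewrite mxE eqxx addr0 eq_sym.
by rewrite mxE eq_sym (negPf ki).
Qed.

Section SplitCasimir.
Variables (R : realType) (m N : nat) (pi : unitary_rep R m N).
Local Notation dpi := (rep_diff pi).
Implicit Types (X Y : 'M[R[i]]_(N, m)).

(* In the matrix models of V (x) C^m and V (x) conj(C^m) these are the split  *)
(* Casimir operator sum_pq E_pq (x) E_qp, up to sign for the second one.      *)
Definition split_plus X :=
  \sum_p \sum_q dpi (delta_mx p q) *m X *m delta_mx p q.
Definition split_minus X :=
  \sum_p \sum_q dpi (delta_mx p q) *m X *m delta_mx q p.

Let sum_delta : \sum_(p < m) \sum_(q < m)
   ((delta_mx p q : 'M[R[i]]_m) *m delta_mx q p) = m%:R%:M.
Proof.
under eq_bigr => p _ do under eq_bigr => q _ do rewrite mul_delta_mx.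
under eq_bigr => p _ do rewrite sumr_const card_ord.
rewrite sumrMnl -[RHS]scalemx1 scaler_nat; congr (_ *+ _).
exact: sum_delta_diag.
Qed.

Variable rho : weight m.
Hypothesis irr : irrep_of_hw pi rho.

Lemma casimir2_rep : \sum_p \sum_q dpi (delta_mx p q) *m dpi (delta_mx q p) =
  (casimir2_value rho)%:~R%:M.
Proof.
(* Comparing columns means evaluating on the standard basis of V, to which [casimir2_scalar]
   applies. *)
apply/trmx_inj/row_matrixP => i; apply: trmx_inj; rewrite -!tr_col !trmxK !colE.
rewrite mul_scalar_mx -(casimir2_scalar (gl_action_rep pi) irr (memvf _)).
rewrite mulmx_suml; apply: eq_bigr => p _.
by rewrite mulmx_suml; apply: eq_bigr => q _; rewrite /rdact mulmxA.
Qed.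

(** Expand the product of E_pq (x) 1 + 1 (x) E_pq and E_qp (x) 1 + 1 (x) E_qp. The pure terms are
    the Casimir operators of V and of C^m, the latter being m; each of the two mixed sums is
    [split_plus]. *)
Lemma casimir2_tens X : casimir2 (dtens pi) X =
  ((casimir2_value rho)%:~R + m%:R) *: X + 2 *: split_plus X.
Proof.
transitivity (\sum_p \sum_q (dpi (delta_mx p q) *m dpi (delta_mx q p)) *m X
   + X *m (\sum_p \sum_q ((delta_mx p q : 'M[R[i]]_m) *m delta_mx q p))
   + (split_plus X + \sum_q \sum_p dpi (delta_mx p q) *m X *m delta_mx p q)).
  rewrite mulmx_sumr -!big_split; apply: eq_bigr => p _ /=.
  rewrite mulmx_sumr -!big_split; apply: eq_bigr => q _ /=.
  rewrite /dtens !trmx_delta mulmxDr mulmxDl !(mulmxA (dpi _)) -(mulmxA X).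
  rewrite -!addrA.
  by rewrite [X in _ = _ + X]addrC -!addrA.
rewrite [X in _ + (_ + X)]exchange_big /= -/(split_plus X).
under eq_bigr => p _ do rewrite -mulmx_suml.
rewrite -mulmx_suml casimir2_rep sum_delta mul_scalar_mx mul_mx_scalar.
by rewrite scalerDl [2 *: _]scaler_nat mulr2n.
Qed.

(** On conj(C^m) the matrix A acts as right multiplication by - A: the sign squares away in the term
    m and survives in the mixed terms. *)
Lemma casimir2_ctens X : casimir2 (dctens pi) X =
  ((casimir2_value rho)%:~R + m%:R) *: X - 2 *: split_minus X.
Proof.
transitivity (\sum_p \sum_q (dpi (delta_mx p q) *m dpi (delta_mx q p)) *m X
   + X *m (\sum_q \sum_p ((delta_mx q p : 'M[R[i]]_m) *m delta_mx p q))
   - (split_minus X + \sum_q \sum_p dpi (delta_mx p q) *m X *m delta_mx q p)).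
  rewrite [X in _ *m X]exchange_big /=.
  rewrite mulmx_sumr -!big_split -sumrB; apply: eq_bigr => p _ /=.
  rewrite mulmx_sumr -!big_split -sumrB; apply: eq_bigr => q _ /=.
  rewrite /dctens mulmxBr mulmxBl !mulmxA opprB.
  move: (_ *m dpi _ *m X) (_ *m delta_mx q p *m _)
    (_ *m X *m _) (dpi _ *m X *m _).
  by move=> ? ? ? ?; apply/matrixP => i j; rewrite !mxE; ring.
rewrite [X in _ - (_ + X)]exchange_big /= -/(split_minus X).
under eq_bigr => p _ do rewrite -mulmx_suml.
rewrite -mulmx_suml casimir2_rep sum_delta mul_scalar_mx mul_mx_scalar.
by rewrite scalerDl [2 *: _]scaler_nat mulr2n.
Qed.

End SplitCasimir.

(** * Orthogonal projections onto the summands *)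

Section Projections.
Variables (R : realType) (m N : nat) (pi : unitary_rep R m N).
Local Notation dpi := (rep_diff pi).
Implicit Types (X Y : 'M[R[i]]_(N, m)).

Lemma hdotE X Y : hdot X Y = \sum_i \sum_j X i j * Num.conj (Y i j).
Proof.
rewrite /hdot /mxtrace; apply: eq_bigr => i _; rewrite mxE.
by apply: eq_bigr => j _; rewrite adjME.
Qed.

Lemma hdot_eq0 X : hdot X X = 0 -> X = 0.
Proof.
rewrite hdotE => h; apply/matrixP => i j; rewrite mxE; apply/eqP.
have p (k : 'I_N) (l : 'I_m) : 0 <= X k l * Num.conj (X k l).
  by rewrite mul_conjC_ge0.
move/eqP: h; rewrite psumr_eq0 => [/allP /(_ i)|k _]; last exact: sumr_ge0.
rewrite mem_index_enum => /(_ isT) /=.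
rewrite psumr_eq0 => [/allP /(_ j)|k _]; last exact: p.
by rewrite mem_index_enum => /(_ isT) /=; rewrite mul_conjC_eq0.
Qed.

Lemma hdotDl X X' Y : hdot (X + X') Y = hdot X Y + hdot X' Y.
Proof. by rewrite /hdot mulmxDl linearD. Qed.

Lemma hdotZl (c : R[i]) X Y : hdot (c *: X) Y = c * hdot X Y.
Proof. by rewrite /hdot -scalemxAl linearZ. Qed.

Lemma hdotZr (c : R[i]) X Y : hdot X (c *: Y) = Num.conj c * hdot X Y.
Proof. by rewrite /hdot adjMZ -scalemxAr linearZ. Qed.

Lemma hdotBl X X' Y : hdot (X - X') Y = hdot X Y - hdot X' Y.
Proof. by rewrite hdotDl -scaleN1r hdotZl mulN1r. Qed.

Lemma hdot_suml I (r : seq I) (F : I -> 'M_(N, m)) Y :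
  hdot (\sum_(i <- r) F i) Y = \sum_(i <- r) hdot (F i) Y.
Proof. by rewrite /hdot mulmx_suml linear_sum. Qed.

Lemma hdot_mul2 (P : 'M_N) (Q : 'M_m) X Y :
  hdot (P *m X *m Q) Y = hdot X (adjM P *m Y *m adjM Q).
Proof.
by rewrite /hdot !adjM_mul !adjMK -!mulmxA mxtrace_mulC !mulmxA.
Qed.

Lemma hdotC X Y : hdot X Y = Num.conj (hdot Y X).
Proof.
rewrite !hdotE rmorph_sum; apply: eq_bigr => i _.
rewrite rmorph_sum; apply: eq_bigr => j _.
by rewrite rmorphM /= conjCK mulrC.
Qed.

Lemma hdot_sumr I (r : seq I) (F : I -> 'M_(N, m)) X :
  hdot X (\sum_(i <- r) F i) = \sum_(i <- r) hdot X (F i).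
Proof.
rewrite hdotC hdot_suml rmorph_sum; apply: eq_bigr => i _.
by rewrite [RHS]hdotC.
Qed.

(** Taking adjoints turns E_pq into E_qp in both factors, by [rep_diff_adjM] in the first, and so
    only permutes the sum. *)
Lemma hdot_split_plus X Y : hdot (split_plus pi X) Y = hdot X (split_plus pi Y).
Proof.
rewrite hdot_suml hdot_sumr.
under eq_bigr => p _ do rewrite hdot_suml.
under [RHS]eq_bigr => p _ do rewrite hdot_sumr.
rewrite exchange_big; apply: eq_bigr => p _; apply: eq_bigr => q _.
by rewrite hdot_mul2 -rep_diff_adjM !adjM_delta.
Qed.

Lemma hdot_split_minus X Y :
  hdot (split_minus pi X) Y = hdot X (split_minus pi Y).
Proof.
rewrite hdot_suml hdot_sumr.
under eq_bigr => p _ do rewrite hdot_suml.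
under [RHS]eq_bigr => p _ do rewrite hdot_sumr.
rewrite exchange_big; apply: eq_bigr => p _; apply: eq_bigr => q _.
by rewrite hdot_mul2 -rep_diff_adjM !adjM_delta.
Qed.

Section Summand.
Variables (act dact : 'M[R[i]]_m -> 'M[R[i]]_(N, m) -> 'M[R[i]]_(N, m)).
Variables (la : weight m) (S : summand act dact la).

(** The projection is given only by its orthogonality property. Positivity of [hdot] makes this a
    characterization, from which linearity follows. *)
Lemma sumd_proj_unique X P : P \in sumd_space S ->
  (forall Y, Y \in sumd_space S -> hdot (X - P) Y = 0) -> sumd_proj S X = P.
Proof.
move=> PW hP; have [QW hQ] := sumd_projP S X.
have dW : sumd_proj S X - P \in sumd_space S by exact: rpredB.
apply/eqP; rewrite -subr_eq0; apply/eqP/hdot_eq0.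
have -> : hdot (sumd_proj S X - P) (sumd_proj S X - P) =
    hdot (X - P) (sumd_proj S X - P)
    - hdot (X - sumd_proj S X) (sumd_proj S X - P).
  by rewrite -hdotBl; congr hdot; rewrite opprB [RHS]addrC addrA subrK.
by rewrite (hP _ dW) (hQ _ dW) subrr.
Qed.

Lemma sumd_proj_linear : linear (sumd_proj S).
Proof.
move=> z X Y; have [XW hX] := sumd_projP S X; have [YW hY] := sumd_projP S Y.
apply: sumd_proj_unique => [|Z ZW]; first by rewrite rpredD // rpredZ.
rewrite opprD addrACA -scalerBr hdotDl hdotZl (hX _ ZW) (hY _ ZW).
by rewrite mulr0 addr0.
Qed.

(** A self-adjoint F that is scalar on the summand preserves the orthogonal complement, so nothing
    about the other summands has to be known. The scalar is an integer, hence its own conjugate. *)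
Lemma sumd_proj_selfadjoint
    (F : 'M[R[i]]_(N, m) -> 'M[R[i]]_(N, m)) (c : int) X :
  (forall X Y, hdot (F X) Y = hdot X (F Y)) ->
  (forall Y, Y \in sumd_space S -> F Y = c%:~R *: Y) ->
  sumd_proj S (F X) = c%:~R *: sumd_proj S X.
Proof.
move=> Fadj Fc; have [XW hX] := sumd_projP S X.
apply: sumd_proj_unique => [|Y YW]; first by rewrite rpredZ.
rewrite hdotBl Fadj Fc // hdotZl hdotZr rmorph_int -mulrBr -hdotBl hX //.
by rewrite mulr0.
Qed.

End Summand.

Variables (rho : weight m) (k : 'I_m).
Hypothesis irr : irrep_of_hw pi rho.

(** By [casimir2_tens], twice the split operator on the summand is the Casimir value of rho + mu_k
    minus that of rho minus m. *)
Lemma sumd_proj_split_plus (S : summand_plus pi rho k) X :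
  sumd_proj S (split_plus pi X) = (- (w_plus rho k))%:~R *: sumd_proj S X.
Proof.
apply: sumd_proj_selfadjoint => [|Y YW]; first exact: hdot_split_plus.
(* If the weight is not dominant the summand is zero, and any scalar is correct. *)
have := sumd_spaceP S; case: ifP => [_ irrS|_ S0]; last first.
  move: YW; rewrite S0 memv0 => /eqP ->.
  by rewrite scaler0 /split_plus big1 // => p _; rewrite big1 // => q _;
    rewrite mulmx0 mul0mx.
have := casimir2_scalar (@gl_action_tens _ _ _ pi) irrS YW.
rewrite (casimir2_tens irr) casimir2_value_addmu.
have -> : casimir2_value rho + 2 * (rho k - k%:Z) + m%:Z =
    casimir2_value rho + m%:Z + 2 * - w_plus rho k by rewrite /w_plus; lia.
rewrite !intrD intrM [in RHS]scalerDl -scalerA => /addrI.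
move/(congr1 (GRing.scale 2^-1)); rewrite !(scalerA 2^-1) mulVf ?pnatr_eq0 //.
by rewrite !scale1r.
Qed.

Lemma sumd_proj_split_minus (S : summand_minus pi rho k) X :
  sumd_proj S (split_minus pi X) = (w_minus rho k)%:~R *: sumd_proj S X.
Proof.
apply: sumd_proj_selfadjoint => [|Y YW]; first exact: hdot_split_minus.
have := sumd_spaceP S; case: ifP => [_ irrS|_ S0]; last first.
  move: YW; rewrite S0 memv0 => /eqP ->.
  by rewrite scaler0 /split_minus big1 // => p _; rewrite big1 // => q _;
    rewrite mulmx0 mul0mx.
have := casimir2_scalar (gl_action_ctens pi) irrS YW.
rewrite (casimir2_ctens irr) casimir2_value_submu.
rewrite addrAC intrB intrD intrM [in RHS]scalerBl -scalerA => /addrI/oppr_inj.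
move/(congr1 (GRing.scale 2^-1)); rewrite !(scalerA 2^-1) mulVf ?pnatr_eq0 //.
by rewrite !scale1r.
Qed.

(** c_1 is the image of the identity matrix, so it commutes with the group action and is scalar; on
    a highest weight vector each E_ll contributes [rho l]. *)
Lemma casimir1_scalar : casimir1 pi = (weight_sum rho)%:~R%:M.
Proof.
apply/trmx_inj/row_matrixP => i; apply: trmx_inj; rewrite -!tr_col !trmxK !colE.
rewrite mul_scalar_mx.
apply: (irreducible_hw_scalar (F := mulmx (casimir1 pi)) _ _ _ _ irr (memvf _)).
- exact: act_linear (gl_action_rep pi).
- by move=> z x y; rewrite mulmxDr scalemxAr.
- move=> a v ua; rewrite /ract mulmxA [casimir1 pi](_ : _ = dpi 1%:M).
    rewrite -[1%:M in LHS](unitary_adjMr ua) -{1}[a]mulmx1.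
    by rewrite -(rep_diff_conjr _ _ ua) mulmxA.
  by rewrite /casimir1 sum_delta_diag.
- move=> v [[_ wv] _]; rewrite /casimir1 linear_sum mulmx_suml.
  rewrite /weight_sum rmorph_sum scaler_suml; apply: eq_bigr => l _.
  exact: wv.
Qed.

End Projections.

(** * Smooth functions and vector fields *)

Section Differentiability.
Variables (R : realType) (V W : normedModType R).

(** The remainder estimate sees only values near x; [diff_unique] then identifies the differential
    of h with that of f. *)
Lemma near_eq_differentiable (f h : V -> W) (x : V) :
  (\forall y \near x, f y = h y) -> differentiable f x -> differentiable h x.
Proof.
move=> fh /diff_locallyP[dc df].
have fhx : f x = h x by exact: nbhs_singleton fh.
have fh0 : \forall y \near 0, (f \o shift x) y = (h \o shift x) y.
  move: fh; rewrite (near_shift 0); apply: filterS => y /=; by rewrite subr0.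
have dh : h \o shift x = cst (h x) + 'd f x +o_ 0 id.
  apply/eqaddoP => e e0; move/eqaddoP: df => /(_ e e0) df.
  near=> y; suff <- : (f \o shift x - (cst (f x) + 'd f x)) y =
      (h \o shift x - (cst (h x) + 'd f x)) y by near: y.
  by rewrite !fctE fhx; congr (_ - _); near: y.
have e := diff_unique dc dh.
by apply/diff_locallyP; rewrite e; split.
Unshelve. all: by end_near. Qed.

Lemma differentiable_expR (f : V -> R) x : differentiable f x ->
  differentiable (expR \o f) x.
Proof.
move=> df; apply: differentiable_comp => //.
by apply/derivable1_diffP; exact: derivable_expR.
Qed.

Lemma derive_expR_comp (f : V -> R) x v : differentiable f x ->
  'D_v (expR \o f) x = expR (f x) * 'D_v f x.
Proof.
move=> df.
have de : differentiable (expR : R -> R) (f x).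
  by apply/derivable1_diffP; exact: derivable_expR.
rewrite deriveE; last exact: differentiable_expR.
rewrite diff_comp //= deriveE //.
rewrite -[X in 'd _ _ X = _]mulr1 [LHS]linearZ /= mulrC; congr (_ * _).
by rewrite -deriveE // derive_val.
Qed.

End Differentiability.

Section TimesDifferentiable.
Variables (R : realType) (n : nat) (E : set 'rV[R]_n).
Hypothesis openE : open E.
Implicit Types (f h : 'rV[R]_n -> R) (k : nat).

Lemma times_differentiableS k f :
  times_differentiable k.+1 E f -> times_differentiable k E f.
Proof.
elim: k f => [//|k IH] f [df Df]; split=> // v; apply: IH; exact: Df.
Qed.

(** E is open, so equality on E holds near each of its points and is inherited by all directional
    derivatives. *)
Lemma eq_times_differentiable k f h : (forall u, E u -> f u = h u) ->
  times_differentiable k E f -> times_differentiable k E h.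
Proof.
have near_open (f' h' : 'rV[R]_n -> R) : (forall u, E u -> f' u = h' u) ->
    forall u, E u -> \forall y \near u, f' y = h' y.
  move=> fh u Eu; apply: filterS fh _; exact: open_nbhs_nbhs.
elim: k f h => [//|k IH] f h fh [df Df]; split=> [u Eu|v].
  by apply: near_eq_differentiable (df u Eu); exact: near_open.
apply: IH (Df v) => u Eu; apply: near_eq_derive; exact: near_open.
Qed.

Lemma times_differentiable_cst k c : times_differentiable k E (fun=> c).
Proof.
elim: k c => [//|k IH] c; split=> [u _|v]; first exact: differentiable_cst.
by apply: eq_times_differentiable (IH 0) => u _; rewrite derive_cst.
Qed.

Lemma times_differentiableD k f h : times_differentiable k E f ->
  times_differentiable k E h -> times_differentiable k E (fun u => f u + h u).
Proof.
elim: k f h => [//|k IH] f h [df Df] [dh Dh]; split=> [u Eu|v].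
  by apply: differentiableD; [exact: df|exact: dh].
apply: eq_times_differentiable (IH _ _ (Df v) (Dh v)) => u Eu.
by rewrite -deriveD //; apply: diff_derivable; [exact: df|exact: dh].
Qed.

Lemma times_differentiableM k f h : times_differentiable k E f ->
  times_differentiable k E h -> times_differentiable k E (fun u => f u * h u).
Proof.
elim: k f h => [//|k IH] f h Sf Sh.
have [df Df] := Sf; have [dh Dh] := Sh; split=> [u Eu|v].
  by apply: differentiableM; [exact: df|exact: dh].
have := times_differentiableD (IH _ _ (times_differentiableS Sf) (Dh v))
  (IH _ _ (times_differentiableS Sh) (Df v)).
apply: eq_times_differentiable => u Eu.
by rewrite -deriveM //; apply: diff_derivable; [exact: df|exact: dh].
Qed.

Lemma times_differentiable_expR k f : times_differentiable k E f ->
  times_differentiable k E (fun u => expR (f u)).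
Proof.
elim: k f => [//|k IH] f Sf; have [df Df] := Sf; split=> [u Eu|v].
  by apply: differentiable_expR; exact: df.
have := times_differentiableM (IH _ (times_differentiableS Sf)) (Df v).
apply: eq_times_differentiable => u Eu.
by rewrite -derive_expR_comp //; exact: df.
Qed.

End TimesDifferentiable.

Section ManifoldCalculus.
Variables (R : realType) (n : nat) (M : manifold R n).
Implicit Types (x : M) (U V : set M) (f h : M -> R) (X Y : M -> 'rV[R]_n).

(** Near a point of it, the image contains the part of the chart image of [cdom x] that the
    continuous map [chartV x] sends into U. *)
Lemma open_chart_image U x : open U -> open (chart x @` (U `&` cdom x)).
Proof.
move=> oU; rewrite openE => _ [y [Uy dy] <-].
have img : (chart x @` cdom x) (chart x y) by exists y.
have n1 : nbhs (chart x y) (chart x @` cdom x).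
  by apply: open_nbhs_nbhs; split=> //; exact: chart_image_open.
have n2 : nbhs (chart x y) (chartV x @^-1` U).
  apply: (chartV_continuous img); rewrite (chartK dy).
  exact: open_nbhs_nbhs.
rewrite /interior; near=> u.
have [z dz zu] : (chart x @` cdom x) u by near: u.
have : (chartV x @^-1` U) u by near: u.
by rewrite -zu /= chartK // => Uz; exists z.
Unshelve. all: by end_near. Qed.

Lemma chart_image_center U x : U x -> (chart x @` (U `&` cdom x)) (chart x x).
Proof. by move=> Ux; exists x => //; split=> //; exact: cdom_center. Qed.

Lemma chartV_image U x u : (chart x @` (U `&` cdom x)) u -> U (chartV x u).
Proof. by move=> [y [Uy dy] <-]; rewrite chartK. Qed.

Lemma msmooth_eq U f h : open U -> (forall y, U y -> f y = h y) ->
  msmooth U f -> msmooth U h.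
Proof.
move=> oU fh sf x k; apply: eq_times_differentiable (sf x k).
  exact: open_chart_image.
by move=> u /chartV_image; exact: fh.
Qed.

Lemma msmooth_subset U V f : V `<=` U -> msmooth U f -> msmooth V f.
Proof.
move=> VU sf x k.
have EE : chart x @` (V `&` cdom x) `<=` chart x @` (U `&` cdom x).
  by move=> _ [y [Vy dy] <-]; exists y => //; split=> //; exact: VU.
move: (f \o chartV x) (sf x k) => {sf}f; elim: k f => [//|k IH] f [df Df].
by split=> [u /EE|v]; [exact: df|apply: IH; exact: Df].
Qed.

Lemma msmooth_cst U (c : R) : open U -> msmooth U (fun=> c).
Proof.
rewrite /msmooth /smooth_on => oU x k.
exact: (times_differentiable_cst (open_chart_image oU) k c).
Qed.

Lemma msmoothM U f h : open U -> msmooth U f -> msmooth U h ->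
  msmooth U (fun y => f y * h y).
Proof.
rewrite /msmooth /smooth_on => oU sf sh x k.
exact: (times_differentiableM (open_chart_image oU) (sf x k) (sh x k)).
Qed.

Lemma msmooth_expR U f : open U -> msmooth U f ->
  msmooth U (fun y => expR (f y)).
Proof.
rewrite /msmooth /smooth_on => oU sf x k.
exact: (times_differentiable_expR (open_chart_image oU) (sf x k)).
Qed.

Lemma msmooth_differentiable U f x : U x -> msmooth U f ->
  differentiable (f \o chartV x) (chart x x).
Proof. by move=> Ux /(_ x 1%N)[df _]; apply: df; exact: chart_image_center. Qed.

Lemma der_eq U f h x v : open U -> U x -> (forall y, U y -> f y = h y) ->
  der x v f = der x v h.
Proof.
move=> oU Ux fh; apply: near_eq_derive.
apply: (filterS (P := chart x @` (U `&` cdom x))) => [u /chartV_image|].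
  exact: fh.
apply: open_nbhs_nbhs; split; first exact: open_chart_image.
exact: chart_image_center.
Qed.

Lemma der_cst x v (c : R) : der x v (fun=> c) = 0.
Proof. exact: derive_cst. Qed.

Lemma derM U f h x v : U x -> msmooth U f -> msmooth U h ->
  der x v (fun y => f y * h y) = der x v f * h x + f x * der x v h.
Proof.
move=> Ux sf sh; rewrite /der.
have df := msmooth_differentiable Ux sf.
have dh := msmooth_differentiable Ux sh.
rewrite (_ : _ \o chartV x = (f \o chartV x) * (h \o chartV x)) //.
rewrite (deriveM (diff_derivable df) (diff_derivable dh)) addrC.
rewrite /= (chartK (cdom_center x)) /GRing.scale /=.
by congr (_ + _); rewrite mulrC.
Qed.

Lemma der_expR U f x v : U x -> msmooth U f ->
  der x v (fun y => expR (f y)) = expR (f x) * der x v f.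
Proof.
move=> Ux sf; rewrite /der.
rewrite (_ : _ \o chartV x = expR \o (f \o chartV x)) //.
rewrite (derive_expR_comp _ (msmooth_differentiable Ux sf)) /=.
by rewrite (chartK (cdom_center x)).
Qed.

Lemma der_linear U f x : U x -> msmooth U f -> linear (fun v => der x v f).
Proof.
move=> Ux sf a u v; have df := msmooth_differentiable Ux sf.
by rewrite /der !(deriveE _ df) linearD linearZ.
Qed.

Lemma vf_smooth_eq U X Y : open U -> (forall y, U y -> X y = Y y) ->
  vf_smooth U X -> vf_smooth U Y.
Proof.
move=> oU XY sX V f oV VU sf; apply: msmooth_eq (sX V f oV VU sf) => // y Vy.
by rewrite XY //; exact: VU.
Qed.

Lemma vf_smoothZ U f X : msmooth U f -> vf_smooth U X ->
  vf_smooth U (fun y => f y *: X y).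
Proof.
move=> sf sX V h oV VU sh.
have := msmoothM oV (msmooth_subset VU sf) (sX V h oV VU sh).
apply: msmooth_eq => // y Vy.
by rewrite (linear_propZ (der_linear Vy sh)).
Qed.

Lemma vf_smoothN U X : open U -> vf_smooth U X -> vf_smooth U (fun y => - X y).
Proof.
move=> oU sX.
apply: vf_smooth_eq (vf_smoothZ (msmooth_cst (-1) oU) sX) => // y _.
by rewrite scaleN1r.
Qed.

End ManifoldCalculus.

(** * Connections *)

Section ComplexMatrixParts.
Variables (R : realType) (p q : nat).
Implicit Types (A B : 'M[R]_(p, q)) (Z W : 'M[R[i]]_(p, q)).

Lemma reME Z a b : reM Z a b = complex.Re (Z a b).
Proof. by rewrite mxE. Qed.

Lemma imME Z a b : imM Z a b = complex.Im (Z a b).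
Proof. by rewrite mxE. Qed.

Lemma cplxME A B a b : cplxM A B a b = (A a b +i* B a b)%C.
Proof. by rewrite mxE. Qed.

Lemma reM_cplxM A B : reM (cplxM A B) = A.
Proof. by apply/matrixP => a b; rewrite reME cplxME. Qed.

Lemma imM_cplxM A B : imM (cplxM A B) = B.
Proof. by apply/matrixP => a b; rewrite imME cplxME. Qed.

Lemma cplxM_reim Z : cplxM (reM Z) (imM Z) = Z.
Proof. by apply/matrixP => a b; rewrite cplxME reME imME; case: (Z a b). Qed.

Lemma cplxMP Z W : reM Z = reM W -> imM Z = imM W -> Z = W.
Proof. by move=> e1 e2; rewrite -[Z]cplxM_reim -[W]cplxM_reim e1 e2. Qed.

Lemma reMD Z W : reM (Z + W) = reM Z + reM W.
Proof. by apply/matrixP => a b; rewrite !mxE ReCD. Qed.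

Lemma imMD Z W : imM (Z + W) = imM Z + imM W.
Proof. by apply/matrixP => a b; rewrite !mxE ImCD. Qed.

Lemma reMN Z : reM (- Z) = - reM Z.
Proof. by apply/matrixP => a b; rewrite !mxE ReCN. Qed.

Lemma imMN Z : imM (- Z) = - imM Z.
Proof. by apply/matrixP => a b; rewrite !mxE ImCN. Qed.

Lemma reMZ (c : R[i]) Z :
  reM (c *: Z) = complex.Re c *: reM Z - complex.Im c *: imM Z.
Proof. by apply/matrixP => a b; rewrite !mxE ReCM. Qed.

Lemma imMZ (c : R[i]) Z :
  imM (c *: Z) = complex.Re c *: imM Z + complex.Im c *: reM Z.
Proof. by apply/matrixP => a b; rewrite !mxE ImCM. Qed.

Lemma reM_realZ (c : R) Z : reM ((c%:C)%C *: Z) = c *: reM Z.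
Proof. by rewrite reMZ scale0r subr0. Qed.

Lemma imM_realZ (c : R) Z : imM ((c%:C)%C *: Z) = c *: imM Z.
Proof. by rewrite imMZ scale0r addr0. Qed.

Lemma reM_conjM Z : reM (conjM Z) = reM Z.
Proof. by apply/matrixP => a b; rewrite !mxE ReCJ. Qed.

Lemma imM_conjM Z : imM (conjM Z) = - imM Z.
Proof. by apply/matrixP => a b; rewrite !mxE ImCJ. Qed.

Lemma conjM_realZ (c : R) Z : conjM ((c%:C)%C *: Z) = (c%:C)%C *: conjM Z.
Proof. by apply/matrixP => a b; rewrite !mxE rmorphM /= conj_real. Qed.

End ComplexMatrixParts.

Lemma reM_mul_real (R : realType) p q r
    (Z : 'M[R[i]]_(p, q)) (A : 'M[R]_(q, r)) :
  reM (Z *m map_mx (real_complex R) A) = reM Z *m A.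
Proof.
apply/matrixP => a b; rewrite !mxE (big_morph _ (@ReCD R) (erefl _)).
by apply: eq_bigr => k _; rewrite !mxE ReCM /= mulr0 subr0.
Qed.

Lemma imM_mul_real (R : realType) p q r
    (Z : 'M[R[i]]_(p, q)) (A : 'M[R]_(q, r)) :
  imM (Z *m map_mx (real_complex R) A) = imM Z *m A.
Proof.
apply/matrixP => a b; rewrite !mxE (big_morph _ (@ImCD R) (erefl _)).
by apply: eq_bigr => k _; rewrite !mxE ImCM /= mulr0 add0r.
Qed.

Section Connections.
Variables (R : realType) (n : nat) (M : manifold R n).
Variables (U : set M) (x : M).
Hypotheses (openU : open U) (Ux : U x).
Implicit Types (X Y : M -> 'rV[R]_n) (Z W : M -> 'rV[R[i]]_n) (v : 'rV[R]_n).
Implicit Types (w : 'rV[R[i]]_n) (f : M -> R) (nab : covariant M).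

(** The complex-linear extension of d f to complexified tangent vectors. *)
Definition derC w f : R[i] := (der x (reM w) f +i* der x (imM w) f)%C.

Section OneConnection.
Variable nab : covariant M.
Hypothesis connab : is_connection nab.

Lemma nab_linear Y : vf_smooth U Y -> linear (fun v => nab x v Y).
Proof. by move=> sY a u v; have [h _ _ _] := connab openU; exact: h. Qed.

Lemma nab_scale v f Y : msmooth U f -> vf_smooth U Y ->
  nab x v (fun y => f y *: Y y) = der x v f *: Y x + f x *: nab x v Y.
Proof. by move=> sf sY; have [_ _ h _] := connab openU; exact: h. Qed.

(* By the Leibniz rule for the indicator function of U, which is smooth on U. *)
Lemma nab_local v X Y : vf_smooth U X -> (forall y, U y -> X y = Y y) ->
  nab x v X = nab x v Y.
Proof.
move=> sX XY.
have sY := vf_smooth_eq openU XY sX.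
pose f (y : M) : R := if `[< U y >] then 1 else 0.
have f1 y : U y -> 1 = f y by rewrite /f => /asboolT ->.
have sf : msmooth U f.
  by apply: msmooth_eq (msmooth_cst 1 openU) => // y Uy; rewrite f1.
have df : der x v f = 0.
  by rewrite -(der_eq v openU Ux f1) der_cst.
have fnab X' : vf_smooth U X' -> nab x v X' = nab x v (fun y => f y *: X' y).
  by move=> sX'; rewrite nab_scale // df scale0r add0r -f1 // scale1r.
rewrite (fnab X sX) (fnab Y sY); congr (nab x v); apply/funext => y.
by rewrite /f; case: asboolP => [/XY -> //|_]; rewrite !scale0r.
Qed.

Lemma nab_opp v Y : vf_smooth U Y -> nab x v (fun y => - Y y) = - nab x v Y.
Proof.
move=> sY; have := nab_scale v (msmooth_cst (-1) openU) sY.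
rewrite der_cst scale0r add0r scaleN1r => <-; congr (nab x v).
by apply/funext => y; rewrite scaleN1r.
Qed.

Lemma cvf_smooth_conj Z : cvf_smooth U Z -> cvf_smooth U (fun y => conjM (Z y)).
Proof.
move=> [s1 s2]; split.
  by apply: vf_smooth_eq s1 => // y _; rewrite reM_conjM.
by apply: vf_smooth_eq (vf_smoothN openU s2) => // y _; rewrite imM_conjM.
Qed.

Lemma cvf_smooth_realZ f Z : msmooth U f -> cvf_smooth U Z ->
  cvf_smooth U (fun y => ((f y)%:C)%C *: Z y).
Proof.
move=> sf [s1 s2]; split.
  by apply: vf_smooth_eq (vf_smoothZ sf s1) => // y _; rewrite reM_realZ.
by apply: vf_smooth_eq (vf_smoothZ sf s2) => // y _; rewrite imM_realZ.
Qed.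

Lemma nabC_local w Z W : cvf_smooth U Z -> (forall y, U y -> Z y = W y) ->
  nabC nab x w Z = nabC nab x w W.
Proof.
move=> [s1 s2] ZW; rewrite /nabC /=.
have h v : nab x v (fun y => reM (Z y)) = nab x v (fun y => reM (W y)).
  by apply: nab_local => // y Uy; rewrite ZW.
have k v : nab x v (fun y => imM (Z y)) = nab x v (fun y => imM (W y)).
  by apply: nab_local => // y Uy; rewrite ZW.
by rewrite !h !k.
Qed.

Lemma nabC_realZl (c : R) w Z : cvf_smooth U Z ->
  nabC nab x ((c%:C)%C *: w) Z = (c%:C)%C *: nabC nab x w Z.
Proof.
move=> [s1 s2]; have l1 := linear_propZ (nab_linear s1).
have l2 := linear_propZ (nab_linear s2).
apply: cplxMP; rewrite ?reM_realZ ?imM_realZ /nabC ?reM_cplxM ?imM_cplxM.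
  by rewrite reM_realZ imM_realZ l1 l2 scalerBr.
by rewrite reM_realZ imM_realZ l1 l2 scalerDr.
Qed.

Lemma nabC_realZr w f Z : msmooth U f -> cvf_smooth U Z ->
  nabC nab x w (fun y => ((f y)%:C)%C *: Z y) =
  derC w f *: Z x + ((f x)%:C)%C *: nabC nab x w Z.
Proof.
move=> sf [s1 s2].
have hr v : nab x v (fun y => reM (((f y)%:C)%C *: Z y)) =
    der x v f *: reM (Z x) + f x *: nab x v (fun y => reM (Z y)).
  rewrite -nab_scale //; congr (nab x v).
  by apply/funext => y; rewrite reM_realZ.
have hi v : nab x v (fun y => imM (((f y)%:C)%C *: Z y)) =
    der x v f *: imM (Z x) + f x *: nab x v (fun y => imM (Z y)).
  rewrite -nab_scale //; congr (nab x v).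
  by apply/funext => y; rewrite imM_realZ.
apply: cplxMP; rewrite ?(reMD, imMD, reM_realZ, imM_realZ, reMZ, imMZ) /nabC /=.
  rewrite !reM_cplxM !hr !hi; apply/matrixP => a b; rewrite !mxE; ring.
rewrite !imM_cplxM !hr !hi; apply/matrixP => a b; rewrite !mxE; ring.
Qed.

Lemma nabC_i w Z : cvf_smooth U Z ->
  nabC nab x w (fun y => (0 +i* 1)%C *: Z y) = (0 +i* 1)%C *: nabC nab x w Z.
Proof.
move=> [s1 s2].
have hr v : nab x v (fun y => reM ((0 +i* 1)%C *: Z y)) =
    - nab x v (fun y => imM (Z y)).
  rewrite -nab_opp //; congr (nab x v).
  by apply/funext => y; rewrite reMZ /= scale0r scale1r add0r.
have hi v : nab x v (fun y => imM ((0 +i* 1)%C *: Z y)) =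
    nab x v (fun y => reM (Z y)).
  congr (nab x v).
  by apply/funext => y; rewrite imMZ /= scale0r scale1r add0r.
apply: cplxMP; rewrite ?(reMZ, imMZ) /nabC /= !(reM_cplxM, imM_cplxM) !hr !hi.
  by rewrite scale0r scale1r add0r opprD.
by rewrite scale0r scale1r add0r addrC.
Qed.

End OneConnection.

Section TwoConnections.
Variables nab nab' : covariant M.

Definition nabC_diff w Z := nabC nab' x w Z - nabC nab x w Z.

(** The brackets do not depend on the connection and cancel. *)
Lemma torsionC_diff Z W :
  torsionC nab' Z W x - torsionC nab Z W x =
  nabC_diff (Z x) W - nabC_diff (W x) Z.
Proof.
rewrite /torsionC /torsion /nabC_diff /nabC.
move: (bracket _ _ x) (bracket _ _ x) (bracket _ _ x) (bracket _ _ x).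
move=> b1 b2 b3 b4.
move: (nab x) (nab' x) => D D'.
apply: cplxMP; rewrite !(reMD, reMN, imMD, imMN, reM_cplxM, imM_cplxM);
  apply/matrixP => i j; rewrite !mxE; ring.
Qed.

End TwoConnections.

End Connections.

(** * The metric on vectors of type (1,0) and (0,1) *)

Section MetricAlgebra.
Variables (R : realType) (m : nat) (M : manifold R m.*2).
Variables (J g : M -> 'M[R]_m.*2).
Implicit Types (x : M) (u v : 'rV[R]_m.*2) (z w : 'rV[R[i]]_m.*2).
Local Notation JC x := (map_mx (real_complex R) (J x)).

Lemma gdotDl x u u' v : gdot g x (u + u') v = gdot g x u v + gdot g x u' v.
Proof. by rewrite /gdot !mulmxDl mxE. Qed.

Lemma gdotDr x u v v' : gdot g x u (v + v') = gdot g x u v + gdot g x u v'.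
Proof. by rewrite /gdot linearD mulmxDr mxE. Qed.

Lemma gdotNl x u v : gdot g x (- u) v = - gdot g x u v.
Proof. by rewrite /gdot !mulNmx mxE. Qed.

Lemma gdotNr x u v : gdot g x u (- v) = - gdot g x u v.
Proof. by rewrite /gdot linearN mulmxN mxE. Qed.

Lemma gdotCDl x z z' w : gdotC g x (z + z') w = gdotC g x z w + gdotC g x z' w.
Proof. by rewrite /gdotC !mulmxDl mxE. Qed.

Lemma gdotCZl x (c : R[i]) z w : gdotC g x (c *: z) w = c * gdotC g x z w.
Proof. by rewrite /gdotC -!scalemxAl mxE. Qed.

Lemma gdotCZr x (c : R[i]) z w : gdotC g x z (c *: w) = c * gdotC g x z w.
Proof. by rewrite /gdotC linearZ -scalemxAr mxE. Qed.

Lemma gdotC0l x w : gdotC g x 0 w = 0.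
Proof. by rewrite /gdotC !mul0mx mxE. Qed.

Lemma gdotC0r x w : gdotC g x w 0 = 0.
Proof. by rewrite /gdotC trmx0 mulmx0 mxE. Qed.

Lemma gdotCE x z w : gdotC g x z w =
  ((gdot g x (reM z) (reM w) - gdot g x (imM z) (imM w))
   +i* (gdot g x (reM z) (imM w) + gdot g x (imM z) (reM w)))%C.
Proof.
rewrite /gdotC /gdot -reM_mul_real -imM_mul_real.
move: (z *m _) => y; apply: complexP.
  rewrite [in LHS]mxE (big_morph _ (@ReCD R) (erefl _)) /= [in RHS]mxE.
  rewrite [X in _ - X]mxE -sumrB.
  by apply: eq_bigr => k _; rewrite ![in RHS]mxE [in LHS]mxE ReCM.
rewrite [in LHS]mxE (big_morph _ (@ImCD R) (erefl _)) /= [in RHS]mxE.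
rewrite [X in _ + X]mxE -big_split /=.
by apply: eq_bigr => k _; rewrite ![in RHS]mxE [in LHS]mxE ImCM.
Qed.

Lemma gdotC_sym x z w : (forall u v, gdot g x u v = gdot g x v u) ->
  gdotC g x z w = gdotC g x w z.
Proof.
move=> s; rewrite !gdotCE (s (reM w) (reM z)) (s (imM w) (imM z)).
by rewrite (s (reM w) (imM z)) (s (imM w) (reM z)) [X in (_ +i* X)%C]addrC.
Qed.

Definition type01 x w := w *m JC x = (0 +i* -1)%C *: w.

Lemma conjM_mul_real x w : conjM (w *m JC x) = conjM w *m JC x.
Proof.
apply: cplxMP; first by rewrite reM_conjM !reM_mul_real reM_conjM.
by rewrite imM_conjM !imM_mul_real imM_conjM mulNmx.
Qed.

Lemma type01_conj x w : type10 J x w -> type01 x (conjM w).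
Proof.
rewrite /type10 /type01 -conjM_mul_real => ->.
by apply/matrixP => a b; rewrite !mxE rmorphM.
Qed.

Lemma type10_01_eq0 x w : type10 J x w -> type01 x w -> w = 0.
Proof.
rewrite /type10 /type01 => -> /eqP; rewrite -subr_eq0 -scalerBl.
rewrite scaler_eq0 => /orP[|/eqP //].
by rewrite eq_complex /= opprK -mulr2n pnatr_eq0 andbF.
Qed.

Lemma type10B x z w : type10 J x z -> type10 J x w -> type10 J x (z - w).
Proof. by rewrite /type10 mulmxBl scalerBr => -> ->. Qed.

Lemma type01B x z w : type01 x z -> type01 x w -> type01 x (z - w).
Proof. by rewrite /type01 mulmxBl scalerBr => -> ->. Qed.

Section Invariant.
Variable x : M.
Hypothesis Jinv : forall u v, gdot g x (u *m J x) (v *m J x) = gdot g x u v.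

Lemma gdotC_J z w : gdotC g x (z *m JC x) (w *m JC x) = gdotC g x z w.
Proof. by rewrite !gdotCE !reM_mul_real !imM_mul_real !Jinv. Qed.

(** J multiplies both arguments by i, so invariance reads g(z, w) = i^2 g(z, w). For [gdotC_01] the
    factor is (- i)^2. *)
Lemma gdotC_10 z w : type10 J x z -> type10 J x w -> gdotC g x z w = 0.
Proof.
move=> hz hw; have := gdotC_J z w; rewrite hz hw gdotCZl gdotCZr mulrA.
have -> : (0 +i* 1)%C * (0 +i* 1)%C = -1 :> R[i].
  by apply: complexP; rewrite !ReImE /=; ring.
rewrite mulN1r => /eqP; rewrite eq_sym -subr_eq0 opprK -mulr2n mulrn_eq0 /=.
by move/eqP.
Qed.

Lemma gdotC_01 z w : type01 x z -> type01 x w -> gdotC g x z w = 0.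
Proof.
move=> hz hw; have := gdotC_J z w; rewrite hz hw gdotCZl gdotCZr mulrA.
have -> : (0 +i* -1)%C * (0 +i* -1)%C = -1 :> R[i].
  by apply: complexP; rewrite !ReImE /=; ring.
rewrite mulN1r => /eqP; rewrite eq_sym -subr_eq0 opprK -mulr2n mulrn_eq0 /=.
by move/eqP.
Qed.

End Invariant.

End MetricAlgebra.

(** * Difference of the connections of two conformal metrics *)

Section HermitianConnections.
Variables (R : realType) (m : nat) (M : manifold R m.*2).
Variables (J g : M -> 'M[R]_m.*2) (sigma : M -> R).
Variables (U : set M) (x : M).
Hypotheses (openU : open U) (Ux : U x).
Implicit Types (Z W V : M -> 'rV[R[i]]_m.*2) (w : 'rV[R[i]]_m.*2).
Local Notation JC x := (map_mx (real_complex R) (J x)).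
Let ii : R[i] := (0 +i* 1)%C.

Lemma cvf_smooth_i Z : cvf_smooth U Z -> cvf_smooth U (fun y => ii *: Z y).
Proof.
move=> [s1 s2]; split.
  apply: vf_smooth_eq (vf_smoothN openU s2) => // y _.
  by rewrite reMZ /= scale0r scale1r add0r.
apply: vf_smooth_eq s1 => // y _.
by rewrite imMZ /= scale0r scale1r add0r.
Qed.

Section OneConnection.
Variable nab : covariant M.
Hypothesis connab : is_connection nab.

Lemma nabC_type10 w Z : cvf_smooth U Z -> (forall y, U y -> type10 J y (Z y)) ->
  nabC nab x w (fun y => Z y *m JC y) = ii *: nabC nab x w Z.
Proof.
move=> sZ tZ; rewrite -(nabC_i openU Ux connab) //.
apply/esym/(nabC_local openU Ux connab) => [|y /tZ -> //].
exact: cvf_smooth_i.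
Qed.

Lemma parallel_type10 w Z : parallel_complex J nab -> cvf_smooth U Z ->
  (forall y, U y -> type10 J y (Z y)) -> type10 J x (nabC nab x w Z).
Proof.
move=> parJ sZ tZ; rewrite /type10 -(nabC_type10 w sZ tZ).
have [s1 s2] := sZ.
have h1 v : nab x v (fun y => reM (Z y *m JC y)) =
    nab x v (fun y => reM (Z y)) *m J x.
  rewrite -(parJ U _ x v openU Ux s1); congr (nab x v); apply/funext => y.
  exact: reM_mul_real.
have h2 v : nab x v (fun y => imM (Z y *m JC y)) =
    nab x v (fun y => imM (Z y)) *m J x.
  rewrite -(parJ U _ x v openU Ux s2); congr (nab x v); apply/funext => y.
  exact: imM_mul_real.
apply: cplxMP; rewrite ?reM_mul_real ?imM_mul_real /nabC /=.
  by rewrite !reM_cplxM !h1 !h2 mulmxBl.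
by rewrite !imM_cplxM !h1 !h2 mulmxDl.
Qed.

Lemma nabC_conj w Z : cvf_smooth U Z ->
  nabC nab x (conjM w) (fun y => conjM (Z y)) = conjM (nabC nab x w Z).
Proof.
move=> [s1 s2].
have h1 v : nab x v (fun y => reM (conjM (Z y))) = nab x v (fun y => reM (Z y)).
  by congr (nab x v); apply/funext => y; rewrite reM_conjM.
have h2 v :
    nab x v (fun y => imM (conjM (Z y))) = - nab x v (fun y => imM (Z y)).
  rewrite -(nab_opp openU Ux connab _ s2).
  by congr (nab x v); apply/funext => y; rewrite imM_conjM.
have n1 v : nab x (- v) (fun y => reM (Z y)) = - nab x v (fun y => reM (Z y)).
  exact: (linear_propN (nab_linear openU Ux connab s1)).
have n2 v : nab x (- v) (fun y => imM (Z y)) = - nab x v (fun y => imM (Z y)).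
  exact: (linear_propN (nab_linear openU Ux connab s2)).
apply: cplxMP; rewrite ?(reM_conjM, imM_conjM) /nabC /=.
  by rewrite !reM_cplxM reM_conjM imM_conjM !h1 !h2 n2 opprK.
by rewrite !imM_cplxM reM_conjM imM_conjM !h1 !h2 n1 opprD.
Qed.

(** On a (1,0) field the u(m)-component is half of nab Z - i J nab Z, the (1,0) part of nab Z;
    pairing with a (0,1) vector does not see the part removed. *)
Lemma u_component_gdotC w Z z :
  (forall u v, gdot g x (u *m J x) (v *m J x) = gdot g x u v) ->
  cvf_smooth U Z -> (forall y, U y -> type10 J y (Z y)) -> type01 J x z ->
  gdotC g x (nabC (u_component J nab) x w Z) z = gdotC g x (nabC nab x w Z) z.
Proof.
move=> Jinv sZ tZ tz.
have -> : nabC (u_component J nab) x w Z = 2^-1 *: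
    (nabC nab x w Z + - (nabC nab x w (fun y => Z y *m JC y) *m JC x)).
  have h1 v : nab x v (fun y => reM (Z y *m JC y)) =
      nab x v (Jfield J (fun y => reM (Z y))).
    by congr (nab x v); apply/funext => y; rewrite reM_mul_real.
  have h2 v : nab x v (fun y => imM (Z y *m JC y)) =
      nab x v (Jfield J (fun y => imM (Z y))).
    by congr (nab x v); apply/funext => y; rewrite imM_mul_real.
  have -> : (2^-1 : R[i]) = ((2^-1 : R)%:C)%C.
    by rewrite -[2 in LHS](rmorph_nat (real_complex R)) fmorphV.
  rewrite /nabC /u_component /=.
  apply: cplxMP; rewrite ?(reM_realZ, imM_realZ) ?(reMD, imMD, reMN, imMN).
    rewrite !reM_mul_real !reM_cplxM !h1 !h2 mulmxBl -scalerBr.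
    by congr (_ *: _); rewrite opprD addrACA -opprD.
  rewrite !imM_mul_real !imM_cplxM !h1 !h2 mulmxDl -scalerDr.
  by congr (_ *: _); rewrite addrACA -opprD.
rewrite (nabC_type10 w sZ tZ) -scalemxAl gdotCZl gdotCDl -scaleNr gdotCZl.
(* As J z = - i z, invariance of g gives - i g(J y, z) = g(y, z) for y = nab Z: the two halves
   agree. *)
have := gdotC_J Jinv (nabC nab x w Z) z; rewrite tz gdotCZr => e.
rewrite (_ : - ii = (0 +i* -1)%C); last first.
  by apply: complexP; rewrite /= ?oppr0.
by rewrite e; field.
Qed.

End OneConnection.

Section ConformalConnections.
Variables nab nab' : covariant M.
Local Notation g' := (conformal sigma g).
Hypotheses (metg : is_metric g) (ssig : msmooth setT sigma).
Hypotheses (connab : is_connection nab) (connab' : is_connection nab').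
Hypotheses (parg : parallel_metric g nab) (parg' : parallel_metric g' nab').
Local Notation DC := (nabC_diff x nab nab').

Lemma conformal_gdot y u v :
  gdot g' y u v = expR (2 * sigma y) * gdot g y u v.
Proof. by rewrite /gdot /conformal -scalemxAr -scalemxAl mxE. Qed.

Lemma conformal_gdotC y z w :
  gdotC g' y z w = ((expR (2 * sigma y))%:C)%C * gdotC g y z w.
Proof.
rewrite !gdotCE !conformal_gdot.
by apply: complexP; rewrite !ReImE /=; ring.
Qed.

Let ssU : msmooth U sigma. Proof. exact: msmooth_subset ssig. Qed.

(** Dividing the Leibniz rule for g' by e^(2 sigma) leaves the logarithmic derivative 2 d sigma as
    the only difference from the rule for g. *)
Lemma metric_diff v (X Y : M -> 'rV[R]_m.*2) : vf_smooth U X -> vf_smooth U Y ->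
  gdot g x (nab' x v X - nab x v X) (Y x)
  + gdot g x (X x) (nab' x v Y - nab x v Y)
  = 2 * der x v sigma * gdot g x (X x) (Y x).
Proof.
move=> sX sY; have [_ _ sg] := metg.
have sXY := sg U X Y openU sX sY.
have s2 : msmooth U (fun y => 2 * sigma y).
  exact: msmoothM (msmooth_cst 2 openU) ssU.
have h1 := parg v openU Ux sX sY.
have h2 := parg' v openU Ux sX sY.
have e : (fun y => gdot g' y (X y) (Y y)) =
    (fun y => expR (2 * sigma y) * gdot g y (X y) (Y y)).
  by apply/funext => y; rewrite conformal_gdot.
rewrite e (derM _ Ux (msmooth_expR openU s2) sXY) (der_expR _ Ux s2) in h2.
rewrite (derM _ Ux (msmooth_cst 2 openU) ssU) der_cst mul0r add0r in h2.
rewrite !conformal_gdot h1 -mulrA -!mulrDr in h2.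
have {}h2 := mulfI (lt0r_neq0 (expR_gt0 _)) h2.
rewrite gdotDl gdotDr gdotNl gdotNr addrACA -opprD -h2.
by rewrite addrK.
Qed.

Lemma metric_diffC w Z W : cvf_smooth U Z -> cvf_smooth U W ->
  gdotC g x (DC w Z) (W x) + gdotC g x (Z x) (DC w W) =
  2 * derC x w sigma * gdotC g x (Z x) (W x).
Proof.
move=> [z1 z2] [w1 w2].
pose D v X := nab' x v X - nab x v X.
have h v X Y : vf_smooth U X -> vf_smooth U Y -> gdot g x (D v X) (Y x) =
    2 * der x v sigma * gdot g x (X x) (Y x) - gdot g x (X x) (D v Y).
  by move=> sX sY; rewrite -(metric_diff v sX sY) addrK.
have DE w' V : DC w' V =
    cplxM (D (reM w') (fun y => reM (V y)) - D (imM w') (fun y => imM (V y)))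
          (D (reM w') (fun y => imM (V y)) + D (imM w') (fun y => reM (V y))).
  rewrite /nabC_diff /nabC /= /D; apply: cplxMP.
    by rewrite reMD reMN !reM_cplxM opprD addrACA -opprD.
  by rewrite imMD imMN !imM_cplxM opprD addrACA.
have Zr_Wr v := h v _ _ z1 w1; have Zr_Wi v := h v _ _ z1 w2.
have Zi_Wr v := h v _ _ z2 w1; have Zi_Wi v := h v _ _ z2 w2.
rewrite !DE !gdotCE !(reM_cplxM, imM_cplxM).
move: D Zr_Wr Zr_Wi Zi_Wr Zi_Wi {h DE} => D Zr_Wr Zr_Wi Zi_Wr Zi_Wi.
rewrite !(gdotDl, gdotDr, gdotNl, gdotNr) !Zr_Wr !Zr_Wi !Zi_Wr !Zi_Wi.
by apply: complexP; rewrite !ReImE /=; ring.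
Qed.

(** Equal (1,1)-torsions give D_(conj W) Z = D_Z (conj W). Both connections preserve types, so the
    left side is of type (1,0) and the right side of type (0,1). *)
Lemma chern_diff Z W : parallel_complex J nab -> parallel_complex J nab' ->
  cvf_smooth U Z -> cvf_smooth U W ->
  (forall y, U y -> type10 J y (Z y)) -> (forall y, U y -> type10 J y (W y)) ->
  torsionC nab Z (fun y => conjM (W y)) x = 0 ->
  torsionC nab' Z (fun y => conjM (W y)) x = 0 ->
  DC (conjM (W x)) Z = 0 /\ DC (Z x) (fun y => conjM (W y)) = 0.
Proof.
move=> pJ pJ' sZ sW tZ tW t t'.
have e := torsionC_diff x nab nab' Z (fun y => conjM (W y)).
rewrite t t' subr0 in e; move/esym/eqP: e; rewrite subr_eq0 => /eqP e.
have DZ0 : DC (conjM (W x)) Z = 0.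
  apply: (type10_01_eq0 (J := J) (x := x)).
    by apply: type10B; apply: parallel_type10.
  (* Writing the direction as a conjugate makes [nabC_conj] applicable. *)
  have JJ : conjM (conjM (Z x)) = Z x.
    by apply/matrixP => a b; rewrite !mxE conjCK.
  rewrite -e; apply: type01B; rewrite -[Z x]JJ.
    by rewrite (nabC_conj connab') //; exact/type01_conj/parallel_type10.
  by rewrite (nabC_conj connab) //; exact/type01_conj/parallel_type10.
by rewrite e DZ0.
Qed.

Lemma levi_civita_diff Z W :
  (forall X Y, vf_smooth U X -> vf_smooth U Y -> torsion nab X Y x = 0) ->
  (forall X Y, vf_smooth U X -> vf_smooth U Y -> torsion nab' X Y x = 0) ->
  cvf_smooth U Z -> cvf_smooth U W -> DC (Z x) W = DC (W x) Z.
Proof.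
move=> t t' [z1 z2] [w1 w2].
have e := torsionC_diff x nab nab' Z W.
rewrite /torsionC !t // !t' // subrr in e.
by move/esym/eqP: e; rewrite subr_eq0 => /eqP.
Qed.

(** Koszul argument: T(A, B, C) = g(D_A B, C) is symmetric in A, B, and its part symmetric in B, C
    is prescribed by metricity. *)
Lemma levi_civita_gdotC Z W V :
  (forall X Y, vf_smooth U X -> vf_smooth U Y -> torsion nab X Y x = 0) ->
  (forall X Y, vf_smooth U X -> vf_smooth U Y -> torsion nab' X Y x = 0) ->
  cvf_smooth U Z -> cvf_smooth U W -> cvf_smooth U V ->
  gdotC g x (DC (Z x) W) (V x) =
  derC x (Z x) sigma * gdotC g x (W x) (V x)
  + derC x (W x) sigma * gdotC g x (Z x) (V x)
  - derC x (V x) sigma * gdotC g x (Z x) (W x).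
Proof.
move=> t t' sZ sW sV; have [gsym _ _] := metg.
have sym z w := gdotC_sym z w (gsym x).
pose T (A B C : M -> 'rV[R[i]]_m.*2) := gdotC g x (DC (A x) B) (C x).
pose G (A B C : M -> 'rV[R[i]]_m.*2) : R[i] :=
  derC x (A x) sigma * gdotC g x (B x) (C x).
have Tsym A B C : cvf_smooth U A -> cvf_smooth U B -> T A B C = T B A C.
  by move=> sA sB; rewrite /T (levi_civita_diff t t' sA sB).
have Tmet A B C : cvf_smooth U A -> cvf_smooth U B -> cvf_smooth U C ->
    T A B C = 2 * G A B C - T A C B.
  move=> sA sB sC; rewrite /G mulrA -(metric_diffC (A x) sB sC) /T.
  by rewrite (sym (DC _ C)) addrK.
have Gsym A B C : G A B C = G A C B by rewrite /G (sym (B x)).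
have alg (p a b c : R[i]) : p = 2 * a - (2 * b - (2 * c - p)) -> p = a + c - b.
  move=> e; apply: (mulfI (x := 2)); first by rewrite pnatr_eq0.
  by rewrite mulr2n mulrDl !mul1r {1}e; ring.
apply: (alg (T Z W V) (G Z W V) (G V Z W) (G W Z V)); clearbody T G.
(* Three uses of metricity, alternating with symmetry, lead back to T(Z, W, V) with the opposite
   sign. *)
rewrite {1}Tmet // (Tsym Z V W) // (Tmet V Z W) // (Tsym V W Z) //.
by rewrite (Tmet W V Z) // (Gsym W V Z) (Tsym W Z V).
Qed.

End ConformalConnections.
End HermitianConnections.

(** * Conformal change of the gradients *)

Section ComplexIdentities.
Variable R : realType.

Lemma complex_real_scale (c d1 d2 d3 d4 : R) :
  ((c * d1 - c * d2) +i* (c * d3 + c * d4))%C =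
  (c%:C)%C * ((d1 - d2) +i* (d3 + d4))%C.
Proof. by apply: complexP; rewrite !ReImE /=; ring. Qed.

Lemma complex_leibniz (a1 a2 e d1 d2 d3 d4 : R) (z : R[i]) :
  ((a1 * complex.Re z + e * d1 - (a2 * complex.Im z + e * d2)) +i*
   (a1 * complex.Im z + e * d3 + (a2 * complex.Re z + e * d4)))%C =
  (a1 +i* a2)%C * z + (e%:C)%C * ((d1 - d2) +i* (d3 + d4))%C.
Proof. by case: z => z1 z2; apply: complexP; rewrite !ReImE /=; ring. Qed.

End ComplexIdentities.

Section ConformalGradient.
Variables (R : realType) (m N : nat) (M : manifold R m.*2).
Variables (J g : M -> 'M[R]_m.*2) (sigma : M -> R) (pi : unitary_rep R m N).
Variables (U : set M) (x : M).
Hypotheses (openU : open U) (Ux : U x) (ssig : msmooth setT sigma).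
Local Notation dpi := (rep_diff pi).
Local Notation frame := 'M[R[i]]_(m, m.*2).
Implicit Types (eps : M -> frame) (w : 'rV[R[i]]_m.*2) (c : R).

Let ssU : msmooth U sigma. Proof. exact: msmooth_subset ssig. Qed.

Definition wscale p q c (F : M -> 'M[R[i]]_(p, q)) : M -> 'M[R[i]]_(p, q) :=
  fun y => ((expR (c * sigma y))%:C)%C *: F y.

Lemma msmooth_exp_sigma c : msmooth U (fun y => expR (c * sigma y)).
Proof.
by apply: msmooth_expR => //; apply: msmoothM => //; exact: msmooth_cst.
Qed.

Lemma derC_exp_sigma c w : derC x w (fun y => expR (c * sigma y)) =
  ((c * expR (c * sigma x))%:C)%C * derC x w sigma.
Proof.
have sc : msmooth U (fun y => c * sigma y).
  by apply: msmoothM => //; exact: msmooth_cst.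
have e v : der x v (fun y => expR (c * sigma y)) =
    c * expR (c * sigma x) * der x v sigma.
  rewrite (der_expR _ Ux sc) (derM _ Ux (msmooth_cst c openU) ssU) der_cst.
  by rewrite mul0r add0r mulrA [_ * c]mulrC.
by rewrite /derC !e; apply: complexP; rewrite !ReImE /= mul0r ?subr0 ?addr0.
Qed.

Lemma cvf_smooth_row eps l : cvf_smooth U (fun y => row l (eps y)) ->
  forall c, cvf_smooth U (fun y => row l (wscale c eps y)).
Proof.
move=> se c; have := cvf_smooth_realZ openU (msmooth_exp_sigma c) se.
by congr cvf_smooth; apply/funext => y; rewrite /wscale linearZ.
Qed.

Lemma cmsmooth_wscale p q c (F : M -> 'M[R[i]]_(p, q)) : cmsmooth U F ->
  cmsmooth U (wscale c F).
Proof.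
move=> sF a b; have [s1 s2] := sF a b; have se := msmooth_exp_sigma c.
split.
  apply: msmooth_eq (msmoothM openU se s1) => // y _.
  by rewrite mxE ReCM /= mul0r subr0.
apply: msmooth_eq (msmoothM openU se s2) => // y _.
by rewrite mxE ImCM /= mul0r addr0.
Qed.

Lemma cder_realZl p q (F : M -> 'M[R[i]]_(p, q)) c w : cmsmooth U F ->
  cder x ((c%:C)%C *: w) F = (c%:C)%C *: cder x w F.
Proof.
move=> sF; apply/matrixP => a b; have [s1 s2] := sF a b.
have l1 z v : der x (z *: v) (fun y => complex.Re (F y a b)) =
    z * der x v (fun y => complex.Re (F y a b)).
  exact: (linear_propZ (der_linear Ux s1)).
have l2 z v : der x (z *: v) (fun y => complex.Im (F y a b)) =
    z * der x v (fun y => complex.Im (F y a b)).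
  exact: (linear_propZ (der_linear Ux s2)).
rewrite !mxE /= reM_realZ imM_realZ !l1 !l2.
exact: complex_real_scale.
Qed.

Lemma cder_wscale p q (F : M -> 'M[R[i]]_(p, q)) c w : cmsmooth U F ->
  cder x w (wscale c F) =
  ((expR (c * sigma x))%:C)%C *:
  (((c%:C)%C * derC x w sigma) *: F x + cder x w F).
Proof.
move=> sF; rewrite scalerDr scalerA mulrA -rmorphM [expR _ * c]mulrC.
rewrite -derC_exp_sigma.
apply/matrixP => a b; have [s1 s2] := sF a b; have se := msmooth_exp_sigma c.
have e1 : (fun y => complex.Re (wscale c F y a b)) =
    (fun y => expR (c * sigma y) * complex.Re (F y a b)).
  by apply/funext => y; rewrite mxE ReCM /= mul0r subr0.
have e2 : (fun y => complex.Im (wscale c F y a b)) =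
    (fun y => expR (c * sigma y) * complex.Im (F y a b)).
  by apply/funext => y; rewrite mxE ImCM /= mul0r addr0.
rewrite !mxE /= e1 e2 !(derM _ Ux se s1) !(derM _ Ux se s2).
exact: complex_leibniz.
Qed.

Section Connection.
Variables (h : M -> 'M[R]_m.*2) (nab : covariant M) (eps : M -> frame).
Hypotheses (connab : is_connection nab) (frm : frame_field J h U eps).

Lemma omega_realZl c w :
  omega h nab eps x ((c%:C)%C *: w) = (c%:C)%C *: omega h nab eps x w.
Proof.
have [_ se] := frm; apply/matrixP => k l; rewrite !mxE.
by rewrite (nabC_realZl openU Ux connab _ _ (se l)) gdotCZl.
Qed.

Lemma cov_realZl (f : M -> 'cV[R[i]]_N) c w : cmsmooth U f ->
  cov h pi nab eps f x ((c%:C)%C *: w) = (c%:C)%C *: cov h pi nab eps f x w.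
Proof.
move=> sf; rewrite /cov cder_realZl // omega_realZl linearZ -scalemxAl.
by rewrite scalerDr.
Qed.

Lemma omega_u_component w :
  (forall u v, gdot h x (u *m J x) (v *m J x) = gdot h x u v) ->
  omega h (u_component J nab) eps x w = omega h nab eps x w.
Proof.
move=> Jinv; have [fe se] := frm; apply/matrixP => k l; rewrite !mxE.
apply: (u_component_gdotC openU Ux connab) => //.
  by move=> y /fe[].
by apply: type01_conj; have [] := fe x Ux.
Qed.

Lemma cov_u_component (f : M -> 'cV[R[i]]_N) w :
  (forall u v, gdot h x (u *m J x) (v *m J x) = gdot h x u v) ->
  cov h pi (u_component J nab) eps f x w = cov h pi nab eps f x w.
Proof. by move=> Jinv; rewrite /cov omega_u_component. Qed.

End Connection.

Local Notation g' := (conformal sigma g).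

Lemma frame_field_conformal eps :
  frame_field J g U eps -> frame_field J g' U (wscale (-1) eps).
Proof.
move=> [fe se]; split=> [y Uy|k]; last exact: cvf_smooth_row.
have [t u] := fe y Uy; split=> [k|k l].
  rewrite /type10 /wscale linearZ -scalemxAl (t k) !scalerA.
  by rewrite [X in X *: _]mulrC.
rewrite /wscale !linearZ /= conjM_realZ gdotCZl gdotCZr conformal_gdotC u.
rewrite !mulrA -!rmorphM -!expRD mulN1r.
rewrite [X in expR X](_ : _ = 0) ?expR0 ?mul1r //.
by ring.
Qed.

Section FrameField.
Variables (nab nab' : covariant M) (eps : M -> frame) (f : M -> 'cV[R[i]]_N).
Hypothesis connab' : is_connection nab'.
Hypotheses (frm : frame_field J g U eps) (sf : cmsmooth U f).

Definition omega_diff w : 'M[R[i]]_m := \matrix_(k, l)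
  gdotC g x (nabC_diff x nab nab' w (fun y => row l (eps y)))
            (conjM (row k (eps x))).

(** Differentiating the factor e^(- sigma) of the frame gives the term - d sigma. The two frame
    factors cancel the e^(2 sigma) of the metric. *)
Lemma omega_conformal w : omega g' nab' (wscale (-1) eps) x w =
  omega g nab eps x w + omega_diff w - (derC x w sigma)%:M.
Proof.
have [fe se] := frm; have [_ ue] := fe x Ux.
have gdotCBl a b z : gdotC g x (a - b) z = gdotC g x a z - gdotC g x b z.
  by rewrite gdotCDl -scaleN1r gdotCZl mulN1r.
apply/matrixP => k l; rewrite !mxE /nabC_diff gdotCBl.
rewrite [X in _ = X - _]addrC subrK.
have -> : (fun y => row l (wscale (-1) eps y)) =
    (fun y => ((expR (-1 * sigma y))%:C)%C *: row l (eps y)).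
  by apply/funext => y; rewrite /wscale linearZ.
rewrite (nabC_realZr openU Ux connab' _ (msmooth_exp_sigma _) (se l)).
rewrite derC_exp_sigma /wscale linearZ /= conjM_realZ gdotCZr conformal_gdotC.
rewrite gdotCDl !gdotCZl ue eq_sym.
set G := gdotC g x (nabC nab' _ _ _) _.
set d := derC x w sigma; set t := (_ == _)%:R.
have e : ((expR (-1 * sigma x))%:C)%C * ((expR (-1 * sigma x))%:C)%C *
    ((expR (2 * sigma x))%:C)%C = 1 :> R[i].
  rewrite -!rmorphM -!expRD [X in expR X](_ : _ = 0) ?expR0 //; ring.
rewrite rmorphM rmorphN rmorph1.
transitivity ((((expR (-1 * sigma x))%:C)%C * ((expR (-1 * sigma x))%:C)%C *
    ((expR (2 * sigma x))%:C)%C) * (G - d * t)); first by ring.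
by rewrite e mul1r mulr_natr.
Qed.

(** The first term comes from differentiating e^(c sigma) f, the second from the change of the
    connection matrix. *)
Definition grad_error c (w : 'I_m -> 'rV[R[i]]_m.*2) : 'M[R[i]]_(N, m) :=
  \matrix_(a, k) (((c%:C)%C * derC x (w k) sigma) *: f x
    + dpi (omega_diff (w k) - (derC x (w k) sigma)%:M) *m f x) a 0.

Lemma cov_conformal c w :
  cov g' pi nab' (wscale (-1) eps) (wscale c f) x w =
  ((expR (c * sigma x))%:C)%C *: (cov g pi nab eps f x w
    + (((c%:C)%C * derC x w sigma) *: f x
       + dpi (omega_diff w - (derC x w sigma)%:M) *m f x)).
Proof.
rewrite /cov cder_wscale // omega_conformal /wscale -scalemxAr -scalerDr.
congr (_ *: _); rewrite -[_ + omega_diff w - _]addrA.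
rewrite [dpi (omega _ _ _ _ _ + _)]linearD.
by rewrite mulmxDl [X in X + _ = _]addrC addrACA.
Qed.

(** In the exponent, c comes from the rescaled vector and - 1 from the rescaled direction of
    differentiation. *)
Lemma cov_matrix_conformal c (w : 'I_m -> 'rV[R[i]]_m.*2) :
  \matrix_(a, k) cov g' pi nab' (wscale (-1) eps) (wscale c f) x
     (((expR (-1 * sigma x))%:C)%C *: w k) a 0 =
  ((expR ((c - 1) * sigma x))%:C)%C *:
  (\matrix_(a, k) cov g pi nab eps f x (w k) a 0 + grad_error c w).
Proof.
have frm' := frame_field_conformal frm.
apply/matrixP => a k; rewrite [LHS]mxE.
rewrite (cov_realZl connab' frm' _ _ (cmsmooth_wscale c sf)) cov_conformal.
rewrite scalerA -rmorphM -expRD -mulrDl addrC; move: (cov _ _ _ _ _ _) => C.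
rewrite [LHS]mxE [RHS]mxE; congr (_ * _).
by rewrite [LHS]mxE [RHS]mxE; congr (_ + _); rewrite [RHS]mxE.
Qed.

End FrameField.

End ConformalGradient.

(** * The error term for the two kinds of connections *)

Section GradientError.
Variables (R : realType) (m N : nat) (M : manifold R m.*2).
Variables (J g : M -> 'M[R]_m.*2) (sigma : M -> R) (pi : unitary_rep R m N).
Variables (U : set M) (x : M) (rho : weight m).
Hypotheses (openU : open U) (Ux : U x) (ssig : msmooth setT sigma).
Hypotheses (ahg : is_almost_hermitian J g) (irr : irrep_of_hw pi rho).
Variables (nab nab' : covariant M).
Variables (eps : M -> 'M[R[i]]_(m, m.*2)) (f : M -> 'cV[R[i]]_N).
Hypotheses (connab : is_connection nab) (connab' : is_connection nab').
Hypotheses (parg : parallel_metric g nab).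
Hypotheses (parg' : parallel_metric (conformal sigma g) nab').
Hypothesis (frm : frame_field J g U eps).
Local Notation dpi := (rep_diff pi).
Local Notation e_ k := (row k (eps x)).
Local Notation c_ k := (conjM (row k (eps x))).
Local Notation Odiff := (omega_diff g x nab nab' eps).
Local Notation Err := (grad_error g sigma pi x nab nab' eps f).

Lemma rep_diff_scalar (a : R[i]) : dpi a%:M = (a * (weight_sum rho)%:~R)%:M.
Proof.
rewrite -[a%:M]scalemx1 linearZ -sum_delta_diag -/(casimir1 pi).
rewrite (casimir1_scalar irr).
by rewrite /= scale_scalar_mx.
Qed.

Lemma grad_error_scalar (b : R[i]) (c : R) (w : 'I_m -> 'rV[R[i]]_m.*2) :
  (forall k, Odiff (w k) = (b * derC x (w k) sigma)%:M) ->
  (c%:C)%C + (b - 1) * (weight_sum rho)%:~R = 0 -> Err c w = 0.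
Proof.
move=> hw cb; apply/matrixP => a k; rewrite mxE hw -raddfB /= rep_diff_scalar.
rewrite mul_scalar_mx -scalerDl mxE [X in X * _](_ : _ = 0) ?mul0r ?mxE //.
set d := derC _ _ _.
transitivity (((c%:C)%C + (b - 1) * (weight_sum rho)%:~R) * d); first by ring.
by rewrite cb mul0r.
Qed.

Let smooth_e k : cvf_smooth U (fun y => row k (eps y)).
Proof. by case: frm. Qed.

Let smooth_c k : cvf_smooth U (fun y => conjM (row k (eps y))).
Proof. exact: cvf_smooth_conj. Qed.

Let type_e k y : U y -> type10 J y (row k (eps y)).
Proof. by move=> Uy; case: frm => fe _; have [] := fe y Uy. Qed.

Let gdot_ec k l : gdotC g x (e_ k) (c_ l) = (k == l)%:R.
Proof. by case: frm => fe _; have [] := fe x Ux. Qed.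

Let gdot_cc k l : gdotC g x (c_ k) (c_ l) = 0.
Proof.
have [_ _ Jinv] := ahg.
by apply: (gdotC_01 (J := J)) => //; exact/type01_conj/type_e.
Qed.

Let gdot_ee k l : gdotC g x (e_ k) (e_ l) = 0.
Proof.
by have [_ _ Jinv] := ahg; apply: (gdotC_10 (J := J)) => //; exact: type_e.
Qed.

Let split_entry (A : 'M[R[i]]_N) (s : 'rV[R[i]]_m) (q t : 'I_m) a j :
  (A *m (f x *m s) *m delta_mx q t) a j =
  if j == t then s 0 q * (A *m f x) a 0 else 0.
Proof.
rewrite -[_ *m delta_mx q t]mulmx1 mulmx_delta_mul mulmxA [X in X * _]mxE.
rewrite big_ord1 [X in _ * X]mxE eq_sym.
by case: eqP => _; rewrite ?mulr1 ?mulr0 // mulrC.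
Qed.

Let rank1_entry (s : 'rV[R[i]]_m) a j : (f x *m s) a j = s 0 j * f x a 0.
Proof. by rewrite mxE big_ord1 mulrC. Qed.

Section Chern.
Hypotheses (pJ : parallel_complex J nab) (pJ' : parallel_complex J nab').
Hypothesis tor : forall Z W, cvf_smooth U Z -> cvf_smooth U W ->
  (forall y, U y -> type10 J y (Z y)) -> (forall y, U y -> type10 J y (W y)) ->
  torsionC nab Z (fun y => conjM (W y)) x = 0.
Hypothesis tor' : forall Z W, cvf_smooth U Z -> cvf_smooth U W ->
  (forall y, U y -> type10 J y (Z y)) -> (forall y, U y -> type10 J y (W y)) ->
  torsionC nab' Z (fun y => conjM (W y)) x = 0.

Let chern k l : nabC_diff x nab nab' (c_ k) (fun y => row l (eps y)) = 0 /\
  nabC_diff x nab nab' (e_ l) (fun y => conjM (row k (eps y))) = 0.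
Proof.
apply: (chern_diff openU Ux connab connab' pJ pJ' (smooth_e l) (smooth_e k)).
- by move=> y; exact: type_e.
- by move=> y; exact: type_e.
- by apply: tor => // y; exact: type_e.
- by apply: tor' => // y; exact: type_e.
Qed.

Lemma omega_diff_chern01 j : Odiff (c_ j) = 0.
Proof.
by apply/matrixP => k l; rewrite !mxE (chern j l).1 gdotC0l.
Qed.

(** In the metric identity for e_l and conj e_k the term with D_(e_j) (conj e_k) vanishes, so all of
    2 d sigma falls on D_(e_j) e_l. *)
Lemma omega_diff_chern10 j : Odiff (e_ j) = (2 * derC x (e_ j) sigma)%:M.
Proof.
have [_ metg _] := ahg; apply/matrixP => k l; rewrite !mxE.
have := metric_diffC openU Ux metg ssig parg parg' (e_ j)
  (smooth_e l) (smooth_c k).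
rewrite (chern k j).2 gdotC0r addr0 => ->.
by rewrite gdot_ec mulr_natr eq_sym.
Qed.

End Chern.

Section LeviCivita.
Hypothesis tor : forall X Y, vf_smooth U X -> vf_smooth U Y ->
  torsion nab X Y x = 0.
Hypothesis tor' : forall X Y, vf_smooth U X -> vf_smooth U Y ->
  torsion nab' X Y x = 0.

Let lc Z W V : cvf_smooth U Z -> cvf_smooth U W -> cvf_smooth U V -> _ :=
  @levi_civita_gdotC _ _ _ _ _ _ _ openU Ux _ _ (let: And3 _ h _ := ahg in h)
    ssig parg parg' Z W V tor tor'.

(** Of the three terms of [levi_civita_gdotC], the first is the scalar subtracted here, the second
    vanishes as g(conj e_j, conj e_k) = 0, and the third is the gradient term. *)
Lemma omega_diff_lc01 j : Odiff (c_ j) - (derC x (c_ j) sigma)%:M =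
  - \sum_k derC x (c_ k) sigma *: delta_mx k j.
Proof.
have [_ [gsym _ _] _] := ahg.
apply/matrixP => k l; rewrite !mxE (lc (smooth_c j) (smooth_e l) (smooth_c k)).
rewrite gdot_ec gdot_cc mulr0 addr0 (gdotC_sym _ _ (gsym x)) gdot_ec summxE.
rewrite mulr_natr (eq_sym l k) addrAC subrr add0r (bigD1 k) //= big1 => [|i ik].
  by rewrite !mxE eqxx addr0.
by rewrite !mxE eq_sym (negPf ik) mulr0.
Qed.

(** Here the gradient term vanishes, as g(e_j, e_l) = 0, and the second term remains. *)
Lemma omega_diff_lc10 j : Odiff (e_ j) - (derC x (e_ j) sigma)%:M =
  \sum_l derC x (e_ l) sigma *: delta_mx j l.
Proof.
apply/matrixP => k l; rewrite !mxE (lc (smooth_e j) (smooth_e l) (smooth_c k)).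
rewrite !gdot_ec gdot_ee mulr0 subr0 summxE.
rewrite mulr_natr (eq_sym l k) addrAC subrr add0r (bigD1 l) //= big1 => [|i il].
  by rewrite !mxE eqxx andbT addr0 eq_sym.
by rewrite !mxE (eq_sym l) (negPf il) andbF mulr0.
Qed.

Lemma grad_error_lc01 c : Err c (fun k => c_ k) =
  (c%:C)%C *: (f x *m \row_k derC x (c_ k) sigma)
  - split_plus pi (f x *m \row_k derC x (c_ k) sigma).
Proof.
apply/matrixP => a j; rewrite mxE omega_diff_lc01 linearN mulNmx linear_sum.
set s := \row_k _.
rewrite [RHS]mxE [LHS]mxE; congr (_ + _).
  by rewrite [LHS]mxE [RHS]mxE rank1_entry mxE mulrA.
rewrite [LHS]mxE [RHS]mxE; congr (- _).
rewrite mulmx_suml /split_plus !summxE; apply: eq_bigr => p _.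
rewrite summxE; under [RHS]eq_bigr => q _ do rewrite split_entry.
rewrite -big_mkcond (big_pred1 j) => [|i]; last by rewrite /= eq_sym.
by rewrite /= linearZ -scalemxAl !mxE.
Qed.

Lemma grad_error_lc10 c : Err c (fun k => e_ k) =
  (c%:C)%C *: (f x *m \row_k derC x (e_ k) sigma)
  + split_minus pi (f x *m \row_k derC x (e_ k) sigma).
Proof.
apply/matrixP => a j; rewrite mxE omega_diff_lc10 linear_sum.
set s := \row_k _.
rewrite [RHS]mxE [LHS]mxE; congr (_ + _).
  by rewrite [LHS]mxE [RHS]mxE rank1_entry mxE mulrA.
rewrite mulmx_suml /split_minus exchange_big !summxE; apply: eq_bigr => q _.
rewrite summxE; under [RHS]eq_bigr => p _ do rewrite split_entry.
rewrite -big_mkcond (big_pred1 j) => [|i]; last by rewrite /= eq_sym.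
by rewrite /= linearZ -scalemxAl !mxE.
Qed.

End LeviCivita.

End GradientError.

(** * Transport of local expressions and classes *)

Section Transport.
Variables (R : realType) (m N : nat) (M : manifold R m.*2).
Variables (J g : M -> 'M[R]_m.*2) (pi : unitary_rep R m N).
Implicit Types (sigma : M -> R) (c w : R).
Local Notation frame := 'M[R[i]]_(m, m.*2).

Lemma exp_sigma_neq0 sigma c x : ((expR (c * sigma x))%:C)%C != 0 :> R[i].
Proof. by rewrite fmorph_eq0 gt_eqF // expR_gt0. Qed.

Lemma wscaleK sigma c p q (F : M -> 'M[R[i]]_(p, q)) :
  wscale sigma c (wscale sigma (- c) F) = F.
Proof.
apply/funext => y; rewrite /wscale scalerA -rmorphM -expRD -mulrDl subrr mul0r.
by rewrite expR0 scale1r.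
Qed.

Lemma wpsi_at_wscale (E : lmodType R[i]) sigma w x (z : frame * E) :
  wpsi_at sigma w x z = (((expR (-1 * sigma x))%:C)%C *: z.1,
                         ((expR (w * sigma x))%:C)%C *: z.2).
Proof. by rewrite /wpsi_at mulN1r. Qed.

Lemma wpsi_at_inj (E : lmodType R[i]) sigma w x :
  injective (@wpsi_at _ _ _ sigma E w x).
Proof.
move=> [p v] [p' v']; rewrite !wpsi_at_wscale /= => -[h1 h2].
rewrite (scalerI (exp_sigma_neq0 _ _ _) h1).
by rewrite (scalerI (exp_sigma_neq0 _ _ _) h2).
Qed.

Lemma wpsi_at_surj (E : lmodType R[i]) sigma w x (z : frame * E) :
  exists z0, wpsi_at sigma w x z0 = z.
Proof.
exists ((((expR (-1 * sigma x))%:C)%C)^-1 *: z.1,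
        (((expR (w * sigma x))%:C)%C)^-1 *: z.2).
rewrite wpsi_at_wscale /= !scalerA !divff ?exp_sigma_neq0 // !scale1r.
by case: z.
Qed.

Lemma wpsi_bclass (E : lmodType R[i]) (act : 'M[R[i]]_m -> E -> E) sigma w x
    (p : frame) (v : E) : (forall b z u, act b (z *: u) = z *: act b u) ->
  wpsi_at sigma w x @` bclass act p v =
  bclass act (((expR (-1 * sigma x))%:C)%C *: p)
             (((expR (w * sigma x))%:C)%C *: v).
Proof.
move=> actZ; apply/seteqP; split => [_ [_ [a ua ->] <-]|_ [a ua ->]].
  by exists a => //; rewrite wpsi_at_wscale /= actZ scalemxAr.
exists (a^T *m p, act (adjM a) v); first by exists a.
by rewrite wpsi_at_wscale /= actZ scalemxAr.
Qed.

Lemma ractZ b (z : R[i]) v : ract pi b (z *: v) = z *: ract pi b v.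
Proof. by rewrite /ract scalemxAr. Qed.

(** g is itself the conformal change of g' by - sigma, so the forward lemma applies. *)
Lemma frame_field_conformalV sigma U (eps : M -> frame) : open U ->
  msmooth setT sigma -> frame_field J (conformal sigma g) U eps ->
  frame_field J g U (wscale sigma 1 eps).
Proof.
move=> oU ssig fe.
have sN : msmooth setT (fun y => -1 * sigma y).
  by apply: msmoothM => //; [exact: openT|apply: msmooth_cst; exact: openT].
have := frame_field_conformal oU sN fe.
rewrite (_ : conformal _ (conformal sigma g) = g); last first.
  apply/funext => y; rewrite /conformal scalerA -expRD.
  by rewrite [X in expR X](_ : _ = 0) ?expR0 ?scale1r //; ring.
rewrite (_ : wscale _ _ eps = wscale sigma 1 eps) //.
by apply/funext => y; rewrite /wscale mulrA mulrNN mulr1.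
Qed.

Lemma local_expr_conformal sigma c U eps f s : open U -> msmooth setT sigma ->
  local_expr J g pi U eps f (wpsiV sigma c s) ->
  local_expr J (conformal sigma g) pi U
    (wscale sigma (-1) eps) (wscale sigma c f) s.
Proof.
move=> oU ssig [fe sf e]; split.
- exact: frame_field_conformal.
- exact: cmsmooth_wscale.
move=> y Uy; rewrite -(wpsi_bclass _ _ _ _ _ ractZ) -e // /wpsiV.
apply/seteqP; split => [z sz|_ [z sz <-] //].
by have [z0 z0E] := wpsi_at_surj sigma c y z; exists z0; rewrite //= z0E.
Qed.

Lemma local_expr_conformalV sigma c U eps f s : open U -> msmooth setT sigma ->
  local_expr J (conformal sigma g) pi U eps f s ->
  local_expr J g pi U
    (wscale sigma 1 eps) (wscale sigma (- c) f) (wpsiV sigma c s).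
Proof.
move=> oU ssig [fe sf e]; split.
- exact: frame_field_conformalV.
- exact: cmsmooth_wscale.
move=> y Uy; rewrite /wpsiV e //.
have eE : eps y = ((expR (-1 * sigma y))%:C)%C *: wscale sigma 1 eps y.
  by rewrite -{1}[eps](wscaleK sigma (-1)) opprK.
have fE : f y = ((expR (c * sigma y))%:C)%C *: wscale sigma (- c) f y.
  by rewrite -{1}[f](wscaleK sigma c).
have -> : bclass (ract pi) (eps y) (f y) = wpsi_at sigma c y @`
    bclass (ract pi) (wscale sigma 1 eps y) (wscale sigma (- c) f y).
  by rewrite (wpsi_bclass _ _ _ _ _ ractZ) -eE -fE.
by apply/seteqP; split => z /=; [move=> [z0 bz /wpsi_at_inj <-]|exists z].
Qed.

(** Rescaling is a bijection between local expressions for the two metrics, which gives both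
    inclusions. G and G' stand for the projected derivatives, so both signs are covered. *)
Lemma gradient_transport
    (act : 'M[R[i]]_m -> 'M[R[i]]_(N, m) -> 'M[R[i]]_(N, m))
    (G G' : (M -> frame) -> (M -> 'cV[R[i]]_N) -> 'M[R[i]]_(N, m))
    sigma c x (s : bsection M 'cV[R[i]]_N) :
  msmooth setT sigma -> (forall b z u, act b (z *: u) = z *: act b u) ->
  (forall U eps f, open U -> U x -> frame_field J g U eps -> cmsmooth U f ->
     G' (wscale sigma (-1) eps) (wscale sigma c f) =
     ((expR ((c - 1) * sigma x))%:C)%C *: G eps f) ->
  [set z | exists U eps f, [/\ open U, U x,
     local_expr J (conformal sigma g) pi U eps f s &
     bclass act (eps x) (G' eps f) z]] =
  wpsi_at sigma (c - 1) x @` [set z | exists U eps f, [/\ open U, U x,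
     local_expr J g pi U eps f (wpsiV sigma c s) &
     bclass act (eps x) (G eps f) z]].
Proof.
move=> ssig actZ hG.
have key U eps f : open U -> U x ->
    local_expr J g pi U eps f (wpsiV sigma c s) ->
    bclass act (wscale sigma (-1) eps x)
      (G' (wscale sigma (-1) eps) (wscale sigma c f)) =
    wpsi_at sigma (c - 1) x @` bclass act (eps x) (G eps f).
  by move=> oU Ux [fe sf _]; rewrite (hG U) // (wpsi_bclass _ _ _ _ _ actZ).
apply/seteqP; split => z.
  move=> [U [eps [f [oU Ux le bz]]]].
  have le' := local_expr_conformalV c oU ssig le.
  have := key U _ _ oU Ux le'.
  rewrite wscaleK (_ : wscale sigma (-1) (wscale sigma 1 eps) = eps);
    last first.
    by rewrite -[RHS](wscaleK sigma (-1)) opprK.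
  move=> e; rewrite e in bz; case: bz => z0 bz0 <-.
  by exists z0 => //; exists U, (wscale sigma 1 eps), (wscale sigma (- c) f).
move=> [z0 [U [eps [f [oU Ux le bz]]]] <-].
exists U, (wscale sigma (-1) eps), (wscale sigma c f); split => //.
  exact: local_expr_conformal.
by rewrite (key U) //; exists z0.
Qed.

End Transport.

(** * The transformation laws *)

Section Gradients.
Variables (R : realType) (m N : nat) (M : manifold R m.*2).
Variables (J g : M -> 'M[R]_m.*2) (sigma : M -> R) (pi : unitary_rep R m N).
Variables (rho : weight m) (k : 'I_m).
Variables (Sp : summand_plus pi rho k) (Sm : summand_minus pi rho k).
Hypotheses (ssig : msmooth setT sigma) (ahg : is_almost_hermitian J g).
Hypothesis irr : irrep_of_hw pi rho.
Local Notation g' := (conformal sigma g).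
Local Notation frame := 'M[R[i]]_(m, m.*2).
Implicit Types (eps : M -> frame) (f : M -> 'cV[R[i]]_N) (nab : covariant M).

Lemma tensZ b (z : R[i]) X : tens pi b (z *: X) = z *: tens pi b X.
Proof. by rewrite /tens -scalemxAr -scalemxAl. Qed.

Lemma ctensZ b (z : R[i]) X : ctens pi b (z *: X) = z *: ctens pi b X.
Proof. by rewrite /ctens -scalemxAr -scalemxAl. Qed.

Lemma nab01_conformal U x eps f nab nab' c : open U -> U x ->
  is_connection nab' ->
  frame_field J g U eps -> cmsmooth U f ->
  nab01 g' pi nab' (wscale sigma (-1) eps) (wscale sigma c f) x =
  ((expR ((c - 1) * sigma x))%:C)%C *: (nab01 g pi nab eps f x
    + grad_error g sigma pi x nab nab' eps f c
        (fun k => conjM (row k (eps x)))).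
Proof.
move=> oU Ux cn' fe sf.
rewrite -(cov_matrix_conformal pi oU Ux ssig nab cn' fe sf).
apply/matrixP => a l; rewrite [LHS]mxE [RHS]mxE; congr (cov _ _ _ _ _ _ _ a 0).
by rewrite {1}/wscale linearZ /= conjM_realZ.
Qed.

Lemma nab10_conformal U x eps f nab nab' c : open U -> U x ->
  is_connection nab' ->
  frame_field J g U eps -> cmsmooth U f ->
  nab10 g' pi nab' (wscale sigma (-1) eps) (wscale sigma c f) x =
  ((expR ((c - 1) * sigma x))%:C)%C *: (nab10 g pi nab eps f x
    + grad_error g sigma pi x nab nab' eps f c (fun k => row k (eps x))).
Proof.
move=> oU Ux cn' fe sf.
rewrite -(cov_matrix_conformal pi oU Ux ssig nab cn' fe sf).
apply/matrixP => a l; rewrite [LHS]mxE [RHS]mxE; congr (cov _ _ _ _ _ _ _ a 0).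
by rewrite {1}/wscale linearZ.
Qed.

Lemma kgrad_plus_conformal nab nab' c s :
  is_connection nab' ->
  (forall U x eps f, open U -> U x -> frame_field J g U eps -> cmsmooth U f ->
     sumd_proj Sp (grad_error g sigma pi x nab nab' eps f c
       (fun k => conjM (row k (eps x)))) = 0) ->
  kgrad_plus J g' nab' Sp s =
  wpsi sigma (c - 1) (kgrad_plus J g nab Sp (wpsiV sigma c s)).
Proof.
move=> cn' err; apply/funext => x; rewrite /kgrad_plus /wpsi.
pose G h nb eps f := sumd_proj Sp (nab01 h pi nb eps f x).
have hG U eps f : open U -> U x -> frame_field J g U eps -> cmsmooth U f ->
    G g' nab' (wscale sigma (-1) eps) (wscale sigma c f) =
    ((expR ((c - 1) * sigma x))%:C)%C *: G g nab eps f.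
  move=> oU Ux fe sf; rewrite /G (nab01_conformal nab c oU Ux cn' fe sf).
  have lin := sumd_proj_linear Sp.
  rewrite (linear_propZ lin) (linear_propD lin).
  congr (_ *: _); rewrite -[RHS]addr0; congr (_ + _).
  exact: (err U).
exact: (gradient_transport pi s ssig tensZ hG).
Qed.

Lemma kgrad_minus_conformal nab nab' c s :
  is_connection nab' ->
  (forall U x eps f, open U -> U x -> frame_field J g U eps -> cmsmooth U f ->
     sumd_proj Sm (grad_error g sigma pi x nab nab' eps f c
       (fun k => row k (eps x))) = 0) ->
  kgrad_minus J g' nab' Sm s =
  wpsi sigma (c - 1) (kgrad_minus J g nab Sm (wpsiV sigma c s)).
Proof.
move=> cn' err; apply/funext => x; rewrite /kgrad_minus /wpsi.
pose G h nb eps f := sumd_proj Sm (nab10 h pi nb eps f x).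
have hG U eps f : open U -> U x -> frame_field J g U eps -> cmsmooth U f ->
    G g' nab' (wscale sigma (-1) eps) (wscale sigma c f) =
    ((expR ((c - 1) * sigma x))%:C)%C *: G g nab eps f.
  move=> oU Ux fe sf; rewrite /G (nab10_conformal nab c oU Ux cn' fe sf).
  have lin := sumd_proj_linear Sm.
  rewrite (linear_propZ lin) (linear_propD lin).
  congr (_ *: _); rewrite -[RHS]addr0; congr (_ + _).
  exact: (err U).
exact: (gradient_transport pi s ssig ctensZ hG).
Qed.

Section UComponent.
Variables (h : M -> 'M[R]_m.*2) (nab : covariant M).
Hypotheses (connab : is_connection nab).
Hypothesis hJ : forall x u v, gdot h x (u *m J x) (v *m J x) = gdot h x u v.

(** The connection matrix in a unitary frame only involves pairings with (0,1) vectors, so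
    [u_component_gdotC] allows working with the Levi-Civita connection itself, which is metric and
    torsion-free. *)
Lemma kgrad_plus_u_component s :
  kgrad_plus J h (u_component J nab) Sp s = kgrad_plus J h nab Sp s.
Proof.
apply/funext => x; rewrite /kgrad_plus.
have e U eps f : open U -> U x -> local_expr J h pi U eps f s ->
    nab01 h pi (u_component J nab) eps f x = nab01 h pi nab eps f x.
  move=> oU Ux [fe _ _]; apply/matrixP => a l; rewrite [LHS]mxE [RHS]mxE.
  by rewrite (cov_u_component pi oU Ux connab fe).
apply/seteqP; split => z [U [eps [f [oU Ux le bz]]]]; exists U, eps, f.
  by rewrite -(e U eps f oU Ux le); split.
by rewrite (e U eps f oU Ux le); split.
Qed.

Lemma kgrad_minus_u_component s :
  kgrad_minus J h (u_component J nab) Sm s = kgrad_minus J h nab Sm s.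
Proof.
apply/funext => x; rewrite /kgrad_minus.
have e U eps f : open U -> U x -> local_expr J h pi U eps f s ->
    nab10 h pi (u_component J nab) eps f x = nab10 h pi nab eps f x.
  move=> oU Ux [fe _ _]; apply/matrixP => a l; rewrite [LHS]mxE [RHS]mxE.
  by rewrite (cov_u_component pi oU Ux connab fe).
apply/seteqP; split => z [U [eps [f [oU Ux le bz]]]]; exists U, eps, f.
  by rewrite -(e U eps f oU Ux le); split.
by rewrite (e U eps f oU Ux le); split.
Qed.

End UComponent.

Lemma conformal_almost_hermitian x u v :
  gdot g' x (u *m J x) (v *m J x) = gdot g' x u v.
Proof. by have [_ _ Jinv] := ahg; rewrite !conformal_gdot Jinv. Qed.

Lemma hermitian_torsion h nab U x : open U -> U x ->
  hermitian_connection J h nab ->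
  forall Z W, cvf_smooth U Z -> cvf_smooth U W ->
  (forall y, U y -> type10 J y (Z y)) -> (forall y, U y -> type10 J y (W y)) ->
  torsionC nab Z (fun y => conjM (W y)) x = 0.
Proof. by move=> oU Ux [_ _ _ tor] Z W sZ sW tZ tW; exact: (tor U). Qed.

Lemma hermitian_kgrad_plus nab nab' s :
  hermitian_connection J g nab -> hermitian_connection J g' nab' ->
  kgrad_plus J g' nab' Sp s = wpsi sigma ((weight_sum rho)%:~R - 1)
    (kgrad_plus J g nab Sp (wpsiV sigma (weight_sum rho)%:~R s)).
Proof.
move=> hn hn'; have [cn pg pJ _] := hn; have [cn' pg' pJ' _] := hn'.
apply: kgrad_plus_conformal => // U x eps f oU Ux fe sf.
(* In the directions conj e_k the two connections agree on the frame, whence b = 0 and c = c_1. *)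
rewrite (grad_error_scalar irr f (b := 0))
  ?(linear_prop0 (sumd_proj_linear Sp)) //.
  move=> j; rewrite mul0r (omega_diff_chern01 oU Ux cn cn' fe pJ pJ'
    (hermitian_torsion oU Ux hn) (hermitian_torsion oU Ux hn') j).
  by rewrite raddf0.
by rewrite sub0r mulN1r rmorph_int subrr.
Qed.

Lemma hermitian_kgrad_minus nab nab' s :
  hermitian_connection J g nab -> hermitian_connection J g' nab' ->
  kgrad_minus J g' nab' Sm s = wpsi sigma (- (weight_sum rho)%:~R - 1)
    (kgrad_minus J g nab Sm (wpsiV sigma (- (weight_sum rho)%:~R) s)).
Proof.
move=> hn hn'; have [cn pg pJ _] := hn; have [cn' pg' pJ' _] := hn'.
apply: kgrad_minus_conformal => // U x eps f oU Ux fe sf.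
(* In the directions e_k they differ by 2 d sigma, whence b = 2 and c = - c_1. *)
rewrite (grad_error_scalar irr f (b := 2))
  ?(linear_prop0 (sumd_proj_linear Sm)) //.
  move=> j; rewrite (omega_diff_chern10 oU Ux ssig ahg cn cn' pg pg' fe pJ pJ'
    (hermitian_torsion oU Ux hn) (hermitian_torsion oU Ux hn') j).
  by [].
by rewrite rmorphN rmorph_int [2 - 1](_ : _ = 1) ?mul1r ?addNr //; ring.
Qed.

Lemma levi_civita_kgrad_plus nab nab' s :
  levi_civita g nab -> levi_civita g' nab' ->
  kgrad_plus J g' (u_component J nab') Sp s =
  wpsi sigma (- (w_plus rho k)%:~R - 1) (kgrad_plus J g (u_component J nab) Sp
    (wpsiV sigma (- (w_plus rho k)%:~R) s)).
Proof.
move=> [cn pg tor] [cn' pg' tor']; have [_ _ Jinv] := ahg.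
rewrite (kgrad_plus_u_component cn Jinv).
rewrite (kgrad_plus_u_component cn' conformal_almost_hermitian).
apply: kgrad_plus_conformal => // U x eps f oU Ux fe sf.
rewrite (grad_error_lc01 pi oU Ux ssig ahg f pg pg' fe
  (fun X Y => tor U X Y x oU Ux) (fun X Y => tor' U X Y x oU Ux)).
have lin := sumd_proj_linear Sp.
rewrite (linear_propD lin) (linear_propN lin) (linear_propZ lin).
(* The projected error is (c + w_(+k)) times the projection of f (x) d sigma, which fixes c. *)
rewrite (sumd_proj_split_plus irr) -scalerBl rmorphN rmorph_int rmorphN subrr.
by rewrite scale0r.
Qed.

Lemma levi_civita_kgrad_minus nab nab' s :
  levi_civita g nab -> levi_civita g' nab' ->
  kgrad_minus J g' (u_component J nab') Sm s =
  wpsi sigma (- (w_minus rho k)%:~R - 1) (kgrad_minus J g (u_component J nab) Sm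
    (wpsiV sigma (- (w_minus rho k)%:~R) s)).
Proof.
move=> [cn pg tor] [cn' pg' tor']; have [_ _ Jinv] := ahg.
rewrite (kgrad_minus_u_component cn Jinv).
rewrite (kgrad_minus_u_component cn' conformal_almost_hermitian).
apply: kgrad_minus_conformal => // U x eps f oU Ux fe sf.
rewrite (grad_error_lc10 pi oU Ux ssig ahg f pg pg' fe
  (fun X Y => tor U X Y x oU Ux) (fun X Y => tor' U X Y x oU Ux)).
have lin := sumd_proj_linear Sm.
rewrite (linear_propD lin) (linear_propZ lin).
(* Here the factor is c + w_(-k). *)
rewrite (sumd_proj_split_minus irr) -scalerDl rmorphN rmorph_int addNr.
by rewrite scale0r.
Qed.

End Gradients.

Theorem theorem7p5 (R : realType) (m N : nat) (M : manifold R m.*2)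
    (J g : M -> 'M[R]_m.*2) (sigma : M -> R)
    (rho : weight m) (pi : unitary_rep R m N)
    (Sp : forall k : 'I_m, summand_plus pi rho k)
    (Sm : forall k : 'I_m, summand_minus pi rho k) :
  is_almost_hermitian J g ->
  msmooth setT sigma ->
  dominant rho ->
  irrep_of_hw pi rho ->
  let g' := conformal sigma g in
  let c1 : R := (weight_sum rho)%:~R in
  casimir1 pi = ((weight_sum rho)%:~R)%:M /\
  (integrable J ->
   forall nab nab' : covariant M,
   hermitian_connection J g nab -> hermitian_connection J g' nab' ->
   forall k : 'I_m,
   (forall s', smooth_section J g' pi s' ->
      kgrad_plus J g' nab' (Sp k) s' =
      wpsi sigma (c1 - 1)
        (kgrad_plus J g nab (Sp k) (wpsiV sigma c1 s'))) /\
   (forall s', smooth_section J g' pi s' ->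
      kgrad_minus J g' nab' (Sm k) s' =
      wpsi sigma (- c1 - 1)
        (kgrad_minus J g nab (Sm k) (wpsiV sigma (- c1) s')))) /\
  (forall nab nab' : covariant M,
   levi_civita g nab -> levi_civita g' nab' ->
   forall k : 'I_m,
   (forall s', smooth_section J g' pi s' ->
      kgrad_plus J g' (u_component J nab') (Sp k) s' =
      wpsi sigma (- (w_plus rho k)%:~R - 1)
        (kgrad_plus J g (u_component J nab) (Sp k)
           (wpsiV sigma (- (w_plus rho k)%:~R) s'))) /\
   (forall s', smooth_section J g' pi s' ->
      kgrad_minus J g' (u_component J nab') (Sm k) s' =
      wpsi sigma (- (w_minus rho k)%:~R - 1)
        (kgrad_minus J g (u_component J nab) (Sm k)
           (wpsiV sigma (- (w_minus rho k)%:~R) s')))).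
Proof.
move=> ahg ssig _ irr g' c1; split; first exact: casimir1_scalar irr.
split=> [_ nab nab' hn hn' k|nab nab' lc lc' k]; split=> s' _.
- exact: (hermitian_kgrad_plus (Sp k) ssig irr s' hn hn').
- exact: (hermitian_kgrad_minus (Sm k) ssig ahg irr s' hn hn').
- exact: (levi_civita_kgrad_plus (Sp k) ssig ahg irr s' lc lc').
- exact: (levi_civita_kgrad_minus (Sm k) ssig ahg irr s' lc lc').
Qed.
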